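(* Let $m\le n$, $\lambda>0$ and $p\le 1$. Let $\xi\ge 0$ denote the threshold of $r_{\lambda,p}$ on $[0,\infty)$, i.e. the number such that $r_{\lambda,p}(t)=0$ for $0\le t\le\xi$ and $r_{\lambda,p}$ is strictly increasing on $[\xi,\infty)$. Then there is a function $f_p:\mathbb{R}\to\mathbb{R}$ which is even, strictly increasing and continuous on $[0,\infty)$, differentiable on $(0,\infty)$, and non-differentiable at $0$ if and only if $\xi>0$ (in which case $\partial f_p(0)=[-1,1]$), such that, with $F_p(X)=\sum_{i=1}^{m}f_p(\sigma_i(X))$ for $X\in\mathbb{R}^{m\times n}$, the generalized singular value thresholding operator $\mathcal{R}_{\lambda,p}$ is the proximal mapping of $F_p$: for every $Y\in\mathbb{R}^{m\times n}$, $$\mathcal{R}_{\lambda,p}(Y)=\arg\min_{X\in\mathbb{R}^{m\times n}}\Big\{\tfrac12\|X-Y\|_F^2+\lambda F_p(X)\Big\}.$$ Moreover, if $t\mapsto t-r_{\lambda,p}(t)$ is non-increasing on $[\xi,\infty)$, then $f_p$ is concave on $[0,\infty)$ and $F_p$ satisfies the triangle inequality, i.e. $F_p(X+Y)\le F_p(X)+F_p(Y)$ for all $X,Y\in\mathbb{R}^{m\times n}$.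
   Context: For $X\in\mathbb{R}^{m\times n}$ with $m\le n$, $\sigma(X)=(\sigma_1(X),\dots,\sigma_m(X))$ with $\sigma_1(X)\ge\cdots\ge\sigma_m(X)\ge 0$ is the vector of singular values, and a singular value decomposition is written $X=U[\mathrm{Diag}(\sigma(X)),\mathbf{0}]V^{\top}$ with $U\in\mathbb{R}^{m\times m}$, $V\in\mathbb{R}^{n\times n}$ orthogonal. $\|\cdot\|_F$ is the Frobenius norm. Generalized thresholding operator: for $\lambda>0$, $p\le1$ and $t\in\mathbb{R}$, $r_{\lambda,p}(t)=\mathrm{sign}(t)\max\{0,|t|-\lambda|t|^{p-1}\}$ (with value $0$ at $t=0$). For $w\in\mathbb{R}^m$, $\mathcal{R}_{\lambda,p}(w)=(r_{\lambda,p}(w_1),\dots,r_{\lambda,p}(w_m))^{\top}$. Generalized singular value thresholding operator: for $X=U[\mathrm{Diag}(\sigma(X)),\mathbf{0}]V^{\top}$, $\mathcal{R}_{\lambda,p}(X)=U[\mathrm{Diag}(\mathcal{R}_{\lambda,p}(\sigma(X))),\mathbf{0}]V^{\top}$. $\partial f_p(0)$ denotes the subdifferential of $f_p$ at $0$. The equality with $\arg\min$ means that the operator's value is the minimizer.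
   Formalization: The clause ∂f_p(0)=[-1,1] is false in general (e.g. m=n=1, p=0, λ=4 forces [-1/2,1/2]); it is replaced by ∂f_p(0)=(ξ/λ)[-1,1], which is [-1,1] exactly when ξ=λ, i.e. p=1 or λ=1; ∂ is the limiting subdifferential. *)

(* Defs.v *)
From HB Require Import structures.
From mathcomp Require Import all_boot all_order all_algebra.
From mathcomp Require Import all_classical all_reals all_analysis.

Set Implicit Arguments.
Unset Strict Implicit.
Unset Printing Implicit Defensive.

Import Order.TTheory GRing.Theory Num.Theory.
Import numFieldNormedType.Exports.

Local Open Scope classical_set_scope.
Local Open Scope ring_scope.

(* [0 `^ a] takes a default value for a <> 0, but the factor [Num.sg t] makes
   the value at t = 0 equal to 0 for every p. *)
Definition gthresh (R : realType) (lambda p t : R) : R :=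
  Num.sg t * Num.max 0 (`|t| - lambda * `|t| `^ (p - 1)).

Definition gthreshv (R : realType) (lambda p : R) (m : nat) (w : 'rV[R]_m) :
    'rV[R]_m :=
  map_mx (gthresh lambda p) w.

Definition is_threshold (R : realType) (r : R -> R) (xi : R) : Prop :=
  [/\ 0 <= xi,
      forall t, 0 <= t <= xi -> r t = 0 &
      {in `[xi, +oo[ &, {homo r : s t / s < t}}].

(* The m x n matrix [Diag(w), 0]. *)
Definition rdiag_mx (R : realType) (m n : nat) (w : 'rV[R]_m) : 'M[R]_(m, n) :=
  \matrix_(i, j) (if i == j :> nat then w 0 i else 0).

Definition orthogonal_mx (R : realType) (n : nat) (U : 'M[R]_n) : Prop :=
  U *m U^T = 1%:M.

Definition is_svd (R : realType) (m n : nat) (X : 'M[R]_(m, n))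
    (U : 'M[R]_m) (s : 'rV[R]_m) (V : 'M[R]_n) : Prop :=
  [/\ orthogonal_mx U, orthogonal_mx V,
      (forall i, 0 <= s 0 i),
      (forall i j : 'I_m, (i <= j)%N -> s 0 j <= s 0 i) &
      X = U *m rdiag_mx n s *m V^T].

(* For m <= n, every matrix has a singular value decomposition and its vector
   of singular values is unique, so the default value 0 is never used. *)
Definition sigma (R : realType) (m n : nat) (X : 'M[R]_(m, n)) : 'rV[R]_m :=
  xget 0 [set s | exists U V, is_svd X U s V].

(* The values of the generalized singular value thresholding operator at X,
   over all singular value decompositions of X. *)
Definition gsvt (R : realType) (lambda p : R) (m n : nat) (X : 'M[R]_(m, n)) :
    set 'M[R]_(m, n) :=
  [set Z | exists U s V, is_svd X U s V /\
     Z = U *m rdiag_mx n (gthreshv lambda p s) *m V^T].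

Definition frob_norm (R : realType) (m n : nat) (X : 'M[R]_(m, n)) : R :=
  Num.sqrt (\sum_i \sum_j X i j ^+ 2).

Definition sv_penalty (R : realType) (f : R -> R) (m n : nat)
    (X : 'M[R]_(m, n)) : R :=
  \sum_i f (sigma X 0 i).

Definition argmin (R : realType) (T : Type) (g : T -> R) : set T :=
  [set x | forall z, g x <= g z].

(* liminf_(y -> x, y != x) (f y - f x - v * (y - x)) / |y - x| >= 0 *)
Definition regular_subdiff (R : realType) (f : R -> R) (x : R) : set R :=
  [set v | forall e : R, 0 < e ->
     \forall y \near x, f x + v * (y - x) - e * `|y - x| <= f y].

(* The limiting (Mordukhovich) subdifferential: f is not assumed convex. *)
Definition subdiff (R : realType) (f : R -> R) (x : R) : set R :=
  [set v | exists x_ v_ : nat -> R,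
     [/\ x_ @ \oo --> x, (f \o x_) @ \oo --> f x,
         (forall k, regular_subdiff f (x_ k) (v_ k)) &
         v_ @ \oo --> v]].

Definition concave_on (R : realType) (D : set R) (f : R -> R) : Prop :=
  convex_function (D : set R^o) (fun x : R^o => - f x : R^o).

(* Main.v *)
(* The threshold [xi] satisfies [lambda * xi `^ (p - 1) = xi], and the inverse
   [h] of the thresholding function on [[xi, +oo[] is nondecreasing and
   1-Lipschitz with slopes at least [mu := (2 - p)^-1]. The penalty is
   [f x := F `|x|] with [lambda * F' = h - id], so that
   [g x := lambda * f x + x ^+ 2 / 2] has derivative [h]: [r y] minimizes
   [g x - y * x], with modulus of strong convexity [mu]. Von Neumann's trace
   inequality for the pair [X], [Y - mu *: Z], where [Z] is any thresholded
   value of [Y], lifts this to matrices in a strong form which yields at once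
   that [Z] is a minimizer, that it is the only one, and that it does not
   depend on the singular value decomposition.

   For the triangle inequality, on finitely many points [f] is a nonnegative
   combination of the functions [Num.min ^~ c], for which one bounds
   [\sum_i Num.min (sigma (X + Y) 0 i) c] by projecting away the right singular
   vectors of [X] and [Y] with singular value greater than [c]. *)
Require Import Defs.
From HB Require Import structures.
From mathcomp Require Import all_boot all_order all_algebra fingroup perm.
From mathcomp Require Import all_classical all_reals all_analysis.
From mathcomp Require Import zify ring lra.

Set Implicit Arguments.
Unset Strict Implicit.
Unset Printing Implicit Defensive.

Import Order.TTheory GRing.Theory Num.Theory.
Import numFieldNormedType.Exports.
Local Open Scope classical_set_scope.
Local Open Scope ring_scope.

(** * The threshold as a fixed point *)

Lemma gthresh_gt0E (R : realType) (lambda p t : R) : 0 < t ->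
  gthresh lambda p t = Num.max 0 (t - lambda * t `^ (p - 1)).
Proof. by move=> t0; rewrite /gthresh gtr0_sg// mul1r gtr0_norm. Qed.

Lemma gthresh_ge0 (R : realType) (lambda p t : R) : 0 <= t ->
  0 <= gthresh lambda p t.
Proof.
by move=> t0; rewrite /gthresh mulr_ge0 ?sgr_ge0// le_max lexx.
Qed.

Lemma ler_powRl (R : realType) (a s t : R) : a <= 0 -> 0 < s -> s <= t ->
  t `^ a <= s `^ a.
Proof.
move=> a0 s0 st; have t0 := lt_le_trans s0 st.
rewrite -[a]opprK !(powRN _ (- a)) lef_pV2 ?posrE ?powR_gt0//.
by apply: ge0_ler_powR; rewrite ?nnegrE ?oppr_ge0 ?(ltW s0) ?(ltW t0).
Qed.

(** The point [x0] solves [lambda * x0 ^ (p - 1) = x0], so the thresholding function vanishes there.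
    If [xi < x0], strict growth from [xi] would make it positive at [x0]; if [x0 < xi], its
    vanishing at [xi] forces [xi <= lambda * xi ^ (p - 1) <= x0]. *)
Lemma threshold_fixpoint (R : realType) (lambda p xi : R) : 0 < lambda ->
  p <= 1 -> is_threshold (gthresh lambda p) xi ->
  0 < xi /\ lambda * xi `^ (p - 1) = xi.
Proof.
move=> l0 p1 [xi0 rxi0 rxi].
pose x0 := lambda `^ (2 - p)^-1.
have x0_gt0 : 0 < x0 by rewrite powR_gt0.
have x0E : lambda * x0 `^ (p - 1) = x0.
  have -> : lambda = x0 `^ (2 - p).
    by rewrite /x0 -powRrM mulVf ?powRr1 ?ltW//; lra.
  rewrite -powRD; last by rewrite (gt_eqF x0_gt0) implybT.
  by rewrite (_ : _ + _ = 1) ?powRr1 ?ltW//; lra.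
suff -> : xi = x0 by [].
have rx0 : gthresh lambda p x0 = 0 by rewrite gthresh_gt0E// x0E subrr maxxx.
have [xix0|x0xi|//] := ltgtP xi x0.
  have := rxi xi x0; rewrite !in_itv/= !andbT lexx (ltW xix0) => /(_ isT isT xix0).
  by rewrite rx0 ltNge gthresh_ge0.
have : gthresh lambda p xi = 0 by rewrite rxi0// xi0 lexx.
rewrite gthresh_gt0E ?(lt_trans x0_gt0)// => /eqP; rewrite eq_le ge_max lexx/=.
have := @ler_powRl _ (p - 1) x0 xi; rewrite subr_le0 => /(_ p1 x0_gt0 (ltW x0xi)).
rewrite -(ler_pM2l l0) x0E => xix0 /andP[+ _]; rewrite subr_le0 => /le_trans/(_ xix0).
by rewrite leNgt x0xi.
Qed.

(** With [u = t / s], convexity gives [1 + (p - 1) * (u - 1) <= u ^ (p - 1)], and the factor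
    [lambda * s ^ (p - 1)] is at most [s] beyond the threshold. Hence the slopes of the thresholding
    function there lie between 1 and [2 - p]. *)
Lemma powR_threshold_lip (R : realType) (lambda p xi s t : R) : 0 < lambda ->
  p <= 1 -> 0 < xi -> lambda * xi `^ (p - 1) = xi -> xi <= s -> s <= t ->
  0 <= lambda * s `^ (p - 1) - lambda * t `^ (p - 1) <= (1 - p) * (t - s).
Proof.
move=> l0 p1 xi0 xiE xis st.
have s0 := lt_le_trans xi0 xis; have t0 := lt_le_trans s0 st.
have p1' : p - 1 <= 0 by rewrite subr_le0.
rewrite subr_ge0 ler_pM2l ?ler_powRl//=.
have ls : lambda * s `^ (p - 1) <= s.
  by apply: le_trans (xis); rewrite -[leRHS]xiE ler_pM2l// ler_powRl.
set u := t / s; have u0 : 0 < u by rewrite divr_gt0.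
have -> : t `^ (p - 1) = s `^ (p - 1) * u `^ (p - 1).
  by rewrite -powRM ?ltW// /u mulrCA divff ?mulr1// gt_eqF.
have -> : t - s = s * (u - 1) by rewrite mulrBr mulr1 /u mulrCA divff ?mulr1// gt_eqF.
have u1 : 1 <= u by rewrite ler_pdivlMr// mul1r.
have : 1 + (p - 1) * (u - 1) <= u `^ (p - 1).
  rewrite /powR gt_eqF//; apply: le_trans (expR_ge1Dx _).
  rewrite lerD2l ler_wnM2l// -[in leLHS](addrNK 1 u) addrC le_ln1Dx//.
  by rewrite ltrBrDl subrr.
have : 0 <= (1 - p) * (u - 1) by rewrite mulr_ge0 ?subr_ge0.
have := powR_ge0 u (p - 1); have : 0 <= lambda * s `^ (p - 1).
  by rewrite mulr_ge0 ?powR_ge0 ?ltW.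
move: ls; move: (u `^ _) => b; move: (s `^ _) => a ls a0 b0 c0 bc.
rewrite mulrA -[X in X - _]mulr1 -mulrBr.
have h1 : 1 - b <= (1 - p) * (u - 1) by lra.
by rewrite mulrCA; apply: (le_trans (ler_wpM2l a0 h1)); rewrite ler_wpM2r.
Qed.

(** * The inverse of the thresholding function *)

(* [h] is the inverse of the restriction of [r] to [[xi, +oo[]. *)
Definition threshold_inverse (R : realType) (r : R -> R) (xi mu : R)
    (h : R -> R) : Prop :=
  [/\ 0 < mu, 0 < xi, h 0 = xi,
      forall t, xi <= t -> 0 <= r t /\ h (r t) = t &
      forall x, 0 <= x -> [/\ xi <= h x, x < h x, r (h x) = x &
        forall y, x <= y -> mu * (y - x) <= h y - h x <= y - x]].

Lemma threshold_inverse_exists (R : realType) (lambda p xi : R) : 0 < lambda ->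
  p <= 1 -> is_threshold (gthresh lambda p) xi ->
  exists mu h, threshold_inverse (gthresh lambda p) xi mu h.
Proof.
move=> l0 p1 rxi; have [xi0 xiE] := threshold_fixpoint l0 p1 rxi.
have lip s t := @powR_threshold_lip R lambda p xi s t l0 p1 xi0 xiE.
case: rxi => _ rxi0 rxi.
have rE t : xi <= t -> gthresh lambda p t = t - lambda * t `^ (p - 1).
  move=> xit; rewrite gthresh_gt0E ?(lt_le_trans xi0)//; apply/max_idPr.
  by have := lip _ _ (lexx _) xit; rewrite xiE => /andP[+ _]; lra.
have surj x : 0 <= x -> exists2 t, xi <= t & gthresh lambda p t = x.
  move=> x0; pose k t := t - lambda * t `^ (p - 1).
  (* At [x + xi] the subtracted power is at most its value [xi] at the threshold, so [k (x + xi)] is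
     at least [x]. *)
  have xix : xi <= x + xi by rewrite lerDr.
  have [|||c] := @IVT _ k xi (x + xi) x => //.
  - apply: derivable_within_continuous => t; rewrite in_itv/= => /andP[xit _].
    apply: derivableB => //; apply: derivableM => //; apply: derivable_powR.
    by rewrite in_itv/= andbT (lt_le_trans xi0).
  - have kxi : k xi = 0 by rewrite /k xiE subrr.
    have kx : x <= k (x + xi).
      by have := lip _ _ (lexx _) xix; rewrite xiE /k => /andP[+ _]; lra.
    by rewrite kxi min_l ?max_r ?x0// (le_trans x0).
  - by rewrite in_itv/= => /andP[xic _] kc; exists c => //; rewrite rE.
(* The default 0 is taken only for negative [x]. *)
pose h x := xget 0 [set t | xi <= t /\ gthresh lambda p t = x].
have hP x : 0 <= x -> xi <= h x /\ gthresh lambda p (h x) = x.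
  move=> /surj[t xit tx]; rewrite /h; case: xgetP => [y _ //|/(_ t)] nt.
  by exfalso; apply: nt.
have rinj s t : xi <= s -> xi <= t -> gthresh lambda p s = gthresh lambda p t -> s = t.
  move=> xis xit rst; have [st|st|//] := ltgtP s t.
    by have := rxi s t; rewrite !in_itv/= xis xit rst ltxx => /(_ isT isT st).
  by have := rxi t s; rewrite !in_itv/= xis xit rst ltxx => /(_ isT isT st).
have hK t : xi <= t -> h (gthresh lambda p t) = t.
  move=> xit; have [|xih rh] := hP (gthresh lambda p t).
    by rewrite gthresh_ge0// (le_trans (ltW xi0)).
  exact: rinj.
(* Inverting slopes in [[1, 2 - p]] gives slopes in [[(2 - p)^-1, 1]]. *)
exists (2 - p)^-1, h; split => //.
- by rewrite invr_gt0; lra.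
- by rewrite -[X in h X](rxi0 xi) ?lexx ?(ltW xi0)// hK.
- by move=> t xit; rewrite hK// gthresh_ge0// (le_trans (ltW xi0)).
move=> x x0; have [xih rh] := hP x x0; split => //.
  rewrite -{1}rh rE// ltrBlDr ltrDl mulr_gt0 ?powR_gt0//.
  exact: lt_le_trans xih.
move=> y xy; have [xihy rhy] := hP y (le_trans x0 xy).
have hxy : h x <= h y.
  rewrite leNgt; apply/negP => hyx.
  have := rxi (h y) (h x); rewrite !in_itv/= xih xihy rh rhy => /(_ isT isT hyx).
  by rewrite ltNge xy.
have := lip _ _ xih hxy; move: rh rhy; rewrite !rE// => rhx rhy.
move=> /andP[h1 h2]; rewrite ler_pdivrMl; last by lra.
by apply/andP; split; lra.
Qed.

(** * Construction of the penalty *)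

Lemma lipschitz_cont (R : realType) (f : R -> R) (k : R) :
  (forall x y, `|f y - f x| <= k * `|y - x|) -> continuous f.
Proof.
move=> fk x; apply/cvgrPdist_le => e e0.
have k0 : 0 < `|k| + 1 by rewrite ltr_wpDl.
near=> y; apply: le_trans (fk y x) _.
have : `|x - y| <= e / (`|k| + 1).
  by near: y; apply: cvgr_dist_le => //; rewrite divr_gt0.
rewrite ler_pdivlMr// => /(le_trans _); apply; rewrite mulrC.
by rewrite ler_wpM2l// (le_trans (ler_norm k))// lerDl.
Unshelve. all: by end_near. Qed.

Lemma primitive_exists (R : realType) (q : R -> R) : continuous q ->
  exists F : R -> R, F 0 = 0 /\ forall x : R, 0 <= x -> is_derive x 1 F (q x).
Proof.
move=> cq.
have [F FE] : exists F : R -> R,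
    forall x, 0 <= x -> derivable F x 1 /\ (F^`()%classic) x = q x.
  (* Integrating from -1 makes 0 an interior point, so the derivative at 0 is two-sided. *)
  exists (fun x => \int[@lebesgue_measure R]_(t in `[-1, x]) q t)%R => x x0.
  apply: (@continuous_FTC1 R q (BLeft (-1)) _ (x + 1)).
  - by rewrite ltrDl.
  - apply: continuous_compact_integrable; first exact: segment_compact.
    exact: continuous_subspaceT.
  - by rewrite /= lte_fin; lra.
  - exact: cq.
exists (fun x => F x - F 0); split; first by rewrite subrr.
move=> x x0; have [dF F'x] := FE x x0.
have Fx : is_derive x 1 F (q x) by split => //; rewrite -F'x derive1E.
have -> : q x = q x - 0 by rewrite subr0.
exact: is_deriveB.
Qed.

Lemma ge0_MVT (R : realType) (G g : R -> R) (x y : R) : 0 <= x -> x <= y ->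
    (forall t : R, 0 <= t -> is_derive t 1 G (g t)) ->
  exists2 c, x <= c <= y & G y - G x = g c * (y - x).
Proof.
move=> x0 xy GP; have [|||c] := @MVT_segment _ G g x y => //.
- by move=> t; rewrite in_itv/= => /andP[xt _]; apply: GP; rewrite (le_trans x0)// ltW.
- apply: derivable_within_continuous => t; rewrite in_itv/= => /andP[xt _].
  by have [] := GP t (le_trans x0 xt).
- by rewrite in_itv/= => ? ?; exists c.
Qed.

(* With [g x := lambda * f x + x ^+ 2 / 2] one has [g' = h] on [[0, +oo[];
   the third clause brackets the slopes of the concave [f] by
   [f' = (h - id) / lambda],
   and the last one expresses that [g] is strongly convex with modulus [mu]. *)
Definition prox_penalty (R : realType) (lambda mu : R) (h f : R -> R) : Prop :=
  [/\ f 0 = 0, forall x, f (- x) = f x,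
      forall x y, 0 <= x -> x <= y ->
        (h y - y) * (y - x) <= lambda * (f y - f x) <= (h x - x) * (y - x),
      forall x, 0 < x -> derivable f x 1 &
      forall x z, 0 <= x -> 0 <= z ->
        (h z - z) * (x - z) - (1 - mu) / 2 * (x - z) ^+ 2 <=
        lambda * (f x - f z)].

(** The slopes of [h] lie between [mu] and 1, so [q] is 1-Lipschitz and nonincreasing on [[0, +oo[];
    the mean value theorem for its primitive [F] then gives the brackets. *)
Lemma prox_penalty_exists (R : realType) (lambda : R) (r : R -> R) (xi mu : R)
  (h : R -> R) : 0 < lambda -> threshold_inverse r xi mu h ->
  exists f, prox_penalty lambda mu h f.
Proof.
move=> l0 [mu0 xi0 h0 _ hP].
have hmono x y : 0 <= x -> x <= y -> mu * (y - x) <= h y - h x <= y - x.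
  by move=> x0 xy; have [_ _ _] := hP x x0; exact.
pose q (x : R) := h `|x| - `|x|.
have cq : continuous q.
  apply: (@lipschitz_cont _ q 1) => x y; rewrite mul1r.
  apply: le_trans (ler_dist_dist _ _); rewrite /q.
  have := normr_ge0 x; have := normr_ge0 y.
  move: `|x| `|y| => {}x {}y y0 x0.
  wlog xy : x y x0 y0 / x <= y => [H|].
    have [|/ltW yx] := leP x y; first exact: H.
    by rewrite distrC [leRHS]distrC; exact: H.
  have /andP[] := hmono _ _ x0 xy; have : 0 <= mu * (y - x).
    by rewrite mulr_ge0 ?subr_ge0// ltW.
  move=> h1 h2 h3; rewrite [leRHS]ger0_norm ?subr_ge0// ler_norml; apply/andP; split; lra.
have [F [F0 FP]] := primitive_exists cq.
have hq t : 0 <= t -> q t = h t - t by move=> t0; rewrite /q ger0_norm.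
exists (fun x => lambda^-1 * F `|x|); split.
- by rewrite normr0 F0 mulr0.
- by move=> x; rewrite normrN.
- move=> x y x0 xy; rewrite -mulrBr mulVKf ?gt_eqF// !ger0_norm ?(le_trans x0)//.
  have [c /andP[xc cy] ->] := ge0_MVT x0 xy FP.
  rewrite hq ?(le_trans x0)//.
  apply/andP; split; apply: ler_wpM2r; rewrite ?subr_ge0//.
  + by have /andP[_] := hmono _ _ (le_trans x0 xc) cy; lra.
  + by have /andP[_] := hmono _ _ x0 xc; lra.
- move=> x x0; apply: derivableM => //.
  apply: (@near_eq_derivable _ _ _ F) => //.
    by near=> t; rewrite ger0_norm// ltW//; near: t; exact: lt_nbhsr.
  by have [] := FP _ (ltW x0).
move=> x z x0 z0; rewrite -mulrBr mulVKf ?gt_eqF// !ger0_norm//.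
(* The derivative of [G] is [h t - h z - mu * (t - z)], which has the sign of [t - z]: [G] is least
   at [z]. *)
pose G t := F t - ((h z - z) * (t - z) - (1 - mu) / 2 * (t - z) ^+ 2).
have GP (t : R) : 0 <= t -> is_derive t 1 G (q t - ((h z - z) - (1 - mu) * (t - z))).
  move=> t0; have Ft := FP t t0; apply: is_deriveB.
  apply: is_derive_eq.
  by rewrite /GRing.scale/=; field.
rewrite -subr_ge0.
have -> : F x - F z - ((h z - z) * (x - z) - (1 - mu) / 2 * (x - z) ^+ 2) = G x - G z.
  by rewrite /G; field.
have [zx|/ltW xz] := leP z x.
  have [c /andP[zc cx] ->] := ge0_MVT z0 zx GP.
  rewrite mulr_ge0 ?subr_ge0// hq ?(le_trans z0)//.
  by have /andP[+ _] := hmono _ _ z0 zc; lra.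
rewrite -opprB oppr_ge0.
have [c /andP[xc cz] ->] := ge0_MVT x0 xz GP.
rewrite mulr_le0_ge0 ?subr_ge0// hq ?(le_trans x0)//.
by have /andP[+ _] := hmono _ _ (le_trans x0 xc) cz; lra.
Unshelve. all: by end_near. Qed.

(** * Monotonicity, kink at 0 and concavity of the penalty *)

(** Concavity in first-order form: one half of the slope bracket at [c] serves each side of [c]. *)
Lemma prox_penalty_tangent (R : realType) (lambda mu : R) (h f : R -> R)
    (x c : R) : prox_penalty lambda mu h f -> 0 <= x -> 0 <= c ->
  lambda * (f x - f c) <= (h c - c) * (x - c).
Proof.
move=> [_ _ fb _ _] x0 c0; have [cx|/ltW xc] := leP c x.
  by have /andP[] := fb c x c0 cx.
have /andP[+ _] := fb x c x0 xc.
by rewrite -(opprB x c) -(opprB (f x)) !mulrN lerN2.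
Qed.

Lemma prox_penalty_incr (R : realType) (lambda : R) (r : R -> R) (xi mu : R)
    (h f : R -> R) : 0 < lambda -> threshold_inverse r xi mu h ->
  prox_penalty lambda mu h f -> {in `[0, +oo[ &, {homo f : x y / x < y}}.
Proof.
move=> l0 [_ _ _ _ hP] [_ _ fb _ _] x y; rewrite !in_itv/= !andbT => x0 y0 xy.
have /andP[+ _] := fb x y x0 (ltW xy); have [_ yh _ _] := hP y y0.
rewrite -subr_gt0 -(pmulr_rgt0 _ l0); apply: lt_le_trans.
by rewrite mulr_gt0 ?subr_gt0.
Qed.

(** On [[0, +oo[] the slopes of [f] are positive and largest at 0, where
    [(h 0 - 0) / lambda = xi / lambda]; evenness extends the bound to the line. *)
Lemma prox_penalty_lipschitz (R : realType) (lambda : R) (r : R -> R) (xi mu : R)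
    (h f : R -> R) (x y : R) : 0 < lambda -> threshold_inverse r xi mu h ->
  prox_penalty lambda mu h f -> `|f y - f x| <= xi / lambda * `|y - x|.
Proof.
move=> l0 [_ xi0 h0 _ hP] [_ feven fb _ _].
have fnorm t : f t = f `|t| by have [?|?] := ger0P t; rewrite ?feven.
apply: le_trans (_ : xi / lambda * `| `|y| - `|x| | <= _); last first.
  by rewrite ler_wpM2l ?ler_dist_dist// divr_ge0// ltW.
rewrite (fnorm x) (fnorm y); have := normr_ge0 x; have := normr_ge0 y.
move: `|x| `|y| => {}x {}y y0 x0.
wlog xy : x y x0 y0 / x <= y => [H|].
  have [|/ltW yx] := leP x y; first exact: H.
  by rewrite distrC (distrC y); exact: H.
have [_ xh _ _] := hP x x0; have [_ yh _ _] := hP y y0.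
have [_ _ _ /(_ x x0)] := hP 0 (lexx _); rewrite h0 subr0 => /andP[_ hx].
have /andP[lo up] := fb x y x0 xy.
have yx0 : 0 <= y - x by rewrite subr_ge0.
rewrite [in leRHS]ger0_norm// ger0_norm; last first.
  by rewrite -(pmulr_rge0 _ l0); apply: le_trans lo; rewrite mulr_ge0// subr_ge0 ltW.
rewrite mulrAC ler_pdivlMr// mulrC; apply: le_trans up _.
by rewrite ler_wpM2r//; lra.
Qed.

(** This quantifies the kink at 0: since [h] is nondecreasing, the slopes on [[0, y]] are at least
    [(h y - y) / lambda >= (xi - y) / lambda]. *)
Lemma prox_penalty_ge_near0 (R : realType) (lambda : R) (r : R -> R) (xi mu : R)
    (h f : R -> R) (y : R) : 0 < lambda -> threshold_inverse r xi mu h ->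
  prox_penalty lambda mu h f -> (xi - `|y|) / lambda * `|y| <= f y.
Proof.
move=> l0 [mu0 xi0 h0 _ hP] [f0 feven fb _ _].
have -> : f y = f `|y| by have [?|?] := ger0P y; rewrite ?feven.
have := normr_ge0 y; move: `|y| => {}y y0.
have [_ _ _ /(_ y y0)] := hP 0 (lexx _); rewrite h0 subr0 => /andP[hy _].
have /andP[lo _] := fb 0 y (lexx _) y0.
rewrite mulrAC ler_pdivrMr// mulrC (mulrC (f y)); rewrite f0 !subr0 in lo.
apply: le_trans lo; rewrite mulrC ler_wpM2r//.
by have := mulr_ge0 (ltW mu0) y0; lra.
Qed.

Lemma prox_penalty_not_derivable0 (R : realType) (lambda : R) (r : R -> R)
    (xi mu : R) (h f : R -> R) : 0 < lambda -> threshold_inverse r xi mu h ->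
  prox_penalty lambda mu h f -> ~ derivable f 0 1.
Proof.
move=> l0 rh fP /cvg_ex[/= D /cvgrPdist_lt fD].
have [mu0 xi0 _ _ _] := rh; have [f0 feven _ _ _] := fP.
(* Half the one-sided slope at 0: the difference quotients at [t] and [- t] are at least [e] and at
   most [- e], so no limit is within [e] of both. *)
pose e := xi / (2 * lambda).
have e0 : 0 < e by rewrite divr_gt0// mulr_gt0.
have [d /= d0 {}fD] := fD e e0.
pose t := Num.min (d / 2) (xi / 2).
have t0 : 0 < t by rewrite lt_min !divr_gt0.
have td : t < d by rewrite gt_min ltr_pdivrMr//; apply/orP; left; lra.
have txi : t <= xi / 2 by rewrite ge_min lexx orbT.
have ft := prox_penalty_ge_near0 t l0 rh fP.
have ftt : e <= f t / t.
  rewrite ler_pdivlMr//; apply: le_trans ft; rewrite gtr0_norm//.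
  by rewrite ler_wpM2r ?(ltW t0)// /e invfM mulrA ler_wpM2r ?invr_ge0 ?(ltW l0)//; lra.
have := fD t; have := fD (- t); rewrite /ball_/= !sub0r !opprK normrN gtr0_norm//.
rewrite !oppr_eq0 gt_eqF// => /(_ td isT) + /(_ td isT).
rewrite !addr0 f0 !subr0 /GRing.scale/= !mulr1 feven invrN mulNr opprK mulrC.
by rewrite !ltr_norml => /andP[_ +] /andP[+ _]; rewrite mulrC in ftt *; lra.
Qed.

(** Regular subgradients at any point are bounded by the Lipschitz constant, and so are their
    limits. Conversely the kink makes every value within this bound a regular subgradient at 0, so
    constant sequences suffice. *)
Lemma prox_penalty_subdiff0 (R : realType) (lambda : R) (r : R -> R)
    (xi mu : R) (h f : R -> R) : 0 < lambda -> threshold_inverse r xi mu h ->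
  prox_penalty lambda mu h f ->
  subdiff f 0 = [set xi / lambda * v | v in `[-1, 1]].
Proof.
move=> l0 rh fP; have [mu0 xi0 _ _ _] := rh; have [f0 feven _ _ _] := fP.
have L0 : 0 < xi / lambda by rewrite divr_gt0.
have bound x v : regular_subdiff f x v -> `|v| <= xi / lambda.
  move=> fv; apply/ler_addgt0Pr => e e0.
  have /nbhs_ballP[d /= d0 fd] := fv e e0.
  (* Moving in the direction of the sign of [v] turns [v * (y - x)] into [|v| * (d / 2)]. *)
  pose y := x + Num.sg v * (d / 2).
  have [->|v0] := eqVneq v 0; first by rewrite normr0 addr_ge0// ltW.
  have yx : `|y - x| = d / 2.
    by rewrite /y addrC addKr normrM normr_sg v0 mul1r gtr0_norm ?divr_gt0.
  have /fd : ball x d y.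
    by rewrite /ball/= distrC yx ltr_pdivrMr//; lra.
  have -> : v * (y - x) = `|v| * (d / 2).
    by rewrite /y addrC addKr mulrA [v * _]mulrC -normrEsg.
  have := prox_penalty_lipschitz x y l0 rh fP; rewrite yx ler_norml => /andP[_ h1] h2.
  rewrite -(@ler_pM2r _ (d / 2)) ?divr_gt0// mulrDl; lra.
apply/seteqP; split => [v [x_ [v_ [_ _ xv vv]]]|_ [v /= v1 <-]].
  have vL : `|v| <= xi / lambda.
    rewrite leNgt; apply/negP => /(cvgr_norm_gt v vv)[k _ /(_ k (leqnn k))/=].
    by rewrite ltNge (bound _ _ (xv k)).
  exists (v / (xi / lambda)); last by rewrite mulrCA divff ?mulr1// gt_eqF.
  by rewrite /= in_itv/= -ler_norml normrM normfV (gtr0_norm L0) ler_pdivrMr// mul1r.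
exists (fun=> 0), (fun=> xi / lambda * v); split; [exact: cvg_cst|exact: cvg_cst| |exact: cvg_cst].
move=> _ e e0; near=> y.
rewrite f0 add0r subr0; apply: le_trans (prox_penalty_ge_near0 y l0 rh fP).
(* This radius makes the quadratic error [|y| ^ 2 / lambda] at most [e * |y|]. *)
have yle : `|y| <= e * lambda.
  by rewrite -[y]subr0 distrC; near: y; apply: cvgr_dist_le => //; rewrite mulr_gt0.
have vy : v * y <= `|y|.
  apply: le_trans (ler_norm _) _; rewrite normrM ler_piMl//.
  by move: v1; rewrite in_itv/= -ler_norml.
have : `|y| / lambda * `|y| <= e * `|y| by rewrite ler_wpM2r// ler_pdivrMr.
by have := ler_wpM2l (ltW L0) vy; rewrite mulrA mulrBl mulrBl; lra.
Unshelve. all: by end_near. Qed.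

(** Averaging the tangent inequalities at the convex combination [c] cancels their linear terms. *)
Lemma prox_penalty_concave (R : realType) (lambda mu : R) (h f : R -> R) :
  0 < lambda -> prox_penalty lambda mu h f -> concave_on `[0, +oo[ f.
Proof.
move=> l0 fP t x y; rewrite !inE /= !in_itv/= !andbT => x0 y0.
have [t0 t1] : 0 <= t%:num /\ t%:num <= 1 by split.
set c := (t%:num * x + (1 - t%:num) * y : R).
have -> : conv t (x : convex_lmodType R^o) y = c by [].
have -> : conv t (- f x : R^o) (- f y) = - (t%:num * f x + (1 - t%:num) * f y).
  by rewrite convRE !mulrN -opprD.
have c0 : 0 <= c by rewrite addr_ge0// mulr_ge0// subr_ge0.
have := ler_wpM2l t0 (prox_penalty_tangent fP x0 c0).
have t1' : 0 <= 1 - t%:num by rewrite subr_ge0.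
have := ler_wpM2l t1' (prox_penalty_tangent fP y0 c0).
rewrite lerN2 => h1 h2; rewrite -(ler_pM2l l0); move: h1 h2.
have : t%:num * ((h c - c) * (x - c)) + (1 - t%:num) * ((h c - c) * (y - c)) = 0.
  by rewrite /c; ring.
move: (f c) (_ * (x - c)) (_ * (y - c)) (f x) (f y) (t%:num) => *; lra.
Qed.

(** * The scalar proximal inequality *)

(** The optimality condition [0 <= (h (r y) - y) * (x - r y)] holds with equality beyond the
    threshold, where [h (r y) = y], and below it because [r y = 0] and [h 0 = xi >= y]. Strong
    convexity does the rest. *)
Lemma scalar_prox_ineq (R : realType) (lambda : R) (r : R -> R) (xi mu : R)
    (h f : R -> R) (x y : R) : is_threshold r xi -> threshold_inverse r xi mu h ->
  prox_penalty lambda mu h f -> 0 <= x -> 0 <= y ->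
  lambda * f (r y) + r y ^+ 2 / 2 - y * r y + mu / 2 * (x - r y) ^+ 2 <=
  lambda * f x + x ^+ 2 / 2 - y * x.
Proof.
move=> [_ r0 _] [_ _ h0 rh _] [_ _ _ _ fprox] x0 y0.
have ry0 : 0 <= r y.
  by have [/ltW yxi|/rh[]//] := ltP y xi; rewrite r0// y0.
have hry : 0 <= (h (r y) - y) * (x - r y).
  have [/ltW yxi|/rh[_ ->]] := ltP y xi; last by rewrite subrr mul0r.
  by rewrite r0 ?y0// h0 subr0 mulr_ge0// subr_ge0.
have := fprox x (r y) x0 ry0; move: hry; move: (r y) => z; nra.
Qed.

(** Both [r] and [t - mu * r t] are thus nondecreasing in [t], which keeps the singular values of
    [Z] and [Y - mu *: Z] sorted. When [xi] separates [s] from [t], the slope bound of [h] is used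
    from 0. *)
Lemma thresholding_lipschitz (R : realType) (r : R -> R) (xi mu : R)
    (h : R -> R) (s t : R) : is_threshold r xi -> threshold_inverse r xi mu h ->
  0 <= s -> s <= t -> 0 <= mu * (r t - r s) <= t - s.
Proof.
move=> [_ r0 rincr] [mu0 xi0 h0 rh hP] s0 st.
have [/ltW txi|xit] := ltP t xi.
  by rewrite (r0 t) ?(le_trans s0 st)// (r0 s) ?s0 ?(le_trans st)// subrr mulr0 lexx subr_ge0.
have [sxi|xis] := ltP s xi.
  rewrite (r0 s) ?s0 ?(ltW sxi)// subr0; have [rt0 hrt] := rh t xit.
  have [_ _ _ /(_ (r t) rt0)] := hP 0 (lexx _).
  by rewrite hrt h0 subr0 => /andP[h1 _]; rewrite mulr_ge0 ?(ltW mu0)//=; lra.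
have [rt0 hrt] := rh t xit; have [rs0 hrs] := rh s xis.
have rst : r s <= r t.
  have [->//|nst] := eqVneq s t; apply/ltW/rincr; rewrite ?in_itv/= ?andbT//.
  by rewrite lt_neqAle nst.
have [_ _ _ /(_ (r t) rst)] := hP _ rs0.
by rewrite hrt hrs => /andP[-> _]; rewrite mulr_ge0 ?subr_ge0 ?(ltW mu0).
Qed.

(** * Orthogonal matrices and their compactness *)

Lemma orthogonal_mxC (R : realType) (n : nat) (U : 'M[R]_n) :
  orthogonal_mx U -> U^T *m U = 1%:M.
Proof. exact: mulmx1C. Qed.

Lemma orthogonal_mx1 (R : realType) (n : nat) : orthogonal_mx (1%:M : 'M[R]_n).
Proof. by rewrite /orthogonal_mx trmx1 mulmx1. Qed.

Lemma orthogonal_mx_tr (R : realType) (n : nat) (U : 'M[R]_n) :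
  orthogonal_mx U -> orthogonal_mx U^T.
Proof. by move=> /orthogonal_mxC; rewrite /orthogonal_mx trmxK. Qed.

Lemma orthogonal_mxM (R : realType) (n : nat) (U V : 'M[R]_n) :
  orthogonal_mx U -> orthogonal_mx V -> orthogonal_mx (U *m V).
Proof.
rewrite /orthogonal_mx => UU VV.
by rewrite trmx_mul mulmxA -(mulmxA U) VV mulmx1.
Qed.

Lemma orthogonal_mx_entry (R : realType) (n : nat) (U : 'M[R]_n) :
  orthogonal_mx U <-> forall i j, \sum_k U i k * U j k = (i == j)%:R.
Proof.
split => [UU i j|UU].
  have := congr1 (fun M : 'M[R]_n => M i j) UU; rewrite !mxE => <-.
  by apply: eq_bigr => k _; rewrite !mxE.
by apply/matrixP => i j; rewrite !mxE -UU; apply: eq_bigr => k _; rewrite mxE.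
Qed.

Lemma sum_continuous (R : realType) (T : topologicalType) (I : finType)
    (f : I -> T -> R) : (forall i, continuous (f i)) ->
  continuous (fun x => \sum_i f i x).
Proof.
move=> fc; elim: (index_enum I) => [|i r IHr] x; rewrite /continuous_at.
  by under eq_cvg do rewrite big_nil; rewrite big_nil; exact: cvg_cst.
under eq_cvg do rewrite big_cons; rewrite big_cons.
by apply: cvgD; [exact: fc|exact: IHr].
Qed.

Lemma mul_continuous (R : realType) (T : topologicalType) (f g : T -> R) :
  continuous f -> continuous g -> continuous (fun x => f x * g x).
Proof. by move=> fc gc x; exact: (@continuousM R T f g x (fc x) (gc x)). Qed.

(** The set is closed, being cut out by polynomial equations, and lies in a cube because rows have
    norm 1. Row vectors give access to compactness of products of intervals. *)
Lemma compact_orthogonal (R : realType) (n : nat) :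
  compact [set v : 'rV[R]_(n * n) | orthogonal_mx (vec_mx v)].
Proof.
have cI : compact [set v : 'rV[R]_(n * n) | forall i, (`[-1, 1]%classic : set R) (v ord0 i)].
  apply: (@rV_compact R (n * n) (fun=> `[-1, 1]%classic)) => _.
  exact: segment_compact.
apply: (subclosed_compact _ cI); last first.
  move=> v /= /orthogonal_mx_entry vv i; case/mxvec_indexP: i => i k.
  rewrite in_itv/= -ler_norml -(expr_le1 (n := 2))// -normrX (ger0_norm (sqr_ge0 _)).
  have := vv i i; rewrite eqxx mulr1n => <-.
  rewrite (bigD1 k)//= mxE -expr2 lerDl sumr_ge0// => j _.
  by rewrite -expr2 sqr_ge0.
rewrite (_ : mkset _ = \bigcap_(i in [set: 'I_n * 'I_n])
    [set v : 'rV[R]_(n * n) | \sum_k v 0 (mxvec_index i.1 k) * v 0 (mxvec_index i.2 k)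
       = (i.1 == i.2)%:R]).
  apply: closed_bigI => -[i j] _ /=.
  apply: (@preimage_closed _ _ (fun v : 'rV[R]_(n * n) =>
    \sum_k v 0 (mxvec_index i k) * v 0 (mxvec_index j k)) [set (i == j)%:R]).
    move=> v _; apply: sum_continuous => k {v}.
    by apply: mul_continuous; exact: coord_continuous.
  exact: closed_eq.
apply/seteqP; split => v /=.
  move=> /orthogonal_mx_entry vv [i j] _ /=; rewrite -vv.
  by apply: eq_bigr => k _; rewrite !mxE.
move=> vv; apply/orthogonal_mx_entry => i j; rewrite -(vv (i, j))//=.
by apply: eq_bigr => k _; rewrite !mxE.
Qed.

(** * Existence of the singular value decomposition *)

(* The weights [m - i] are positive and pairwise distinct: a maximizer of this
   functional diagonalizes [X], with sorted diagonal. *)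
Definition diag_weight (R : realType) (m n : nat) (le_mn : (m <= n)%N)
    (N : 'M[R]_(m, n)) : R :=
  \sum_(i < m) (m - i)%:R * N i (widen_ord le_mn i).

Lemma diag_weight_max (R : realType) (m n : nat) (le_mn : (m <= n)%N)
    (X : 'M[R]_(m, n)) :
  exists U V, [/\ orthogonal_mx U, orthogonal_mx V &
    forall U' V', orthogonal_mx U' -> orthogonal_mx V' ->
      diag_weight le_mn (U'^T *m X *m V') <= diag_weight le_mn (U^T *m X *m V)].
Proof.
pose K := [set v : 'rV[R]_(m * m) | orthogonal_mx (vec_mx v)] `*`
          [set v : 'rV[R]_(n * n) | orthogonal_mx (vec_mx v)].
pose f (v : 'rV[R]_(m * m) * 'rV[R]_(n * n)) :=
  diag_weight le_mn ((vec_mx v.1)^T *m X *m vec_mx v.2).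
have K0 : K !=set0 by exists (mxvec 1%:M, mxvec 1%:M); split; rewrite /= mxvecK; exact: orthogonal_mx1.
have cK : compact K by apply: compact_setX; exact: compact_orthogonal.
have [|[u v]] := compact_EVT_max K0 cK (f := f).
  apply: continuous_subspaceT.
  rewrite (_ : f = fun v => \sum_(i < m) (m - i)%:R *
    \sum_(l < n) (\sum_(k < m) v.1 0 (mxvec_index k i) * X k l) * v.2 0 (mxvec_index l (widen_ord le_mn i))).
    apply: sum_continuous => i; apply: mul_continuous => [v|]; first exact: cvg_cst.
    apply: sum_continuous => l; apply: mul_continuous => [|v]; last first.
      apply: (@continuous_comp _ _ _ snd (fun w : 'rV[R]_(n * n) => w 0 _)).
        by case: v => a b; exact: cvg_snd.
      exact: coord_continuous.
    apply: sum_continuous => k; apply: mul_continuous => v; last exact: cvg_cst.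
    apply: (@continuous_comp _ _ _ fst (fun w : 'rV[R]_(m * m) => w 0 _)).
      by case: v => a b; exact: cvg_fst.
    exact: coord_continuous.
  apply/funext => v; apply: eq_bigr => i _; rewrite mxE; congr (_ * _).
  apply: eq_bigr => l _; rewrite !mxE; congr (_ * _).
  by apply: eq_bigr => k _; rewrite !mxE.
rewrite inE => -[/= uo vo] fmax; exists (vec_mx u), (vec_mx v); split => //.
move=> U V Uo Vo; have := fmax (mxvec U, mxvec V); rewrite /f/= !mxvecK.
by apply; rewrite inE; split; rewrite /= mxvecK.
Qed.

Lemma diag_weightD (R : realType) (m n : nat) (le_mn : (m <= n)%N)
    (M N : 'M[R]_(m, n)) :
  diag_weight le_mn (M + N) = diag_weight le_mn M + diag_weight le_mn N.
Proof.
rewrite /diag_weight -big_split; apply: eq_bigr => i _.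
by rewrite !mxE mulrDr.
Qed.

Lemma diag_weightZ (R : realType) (m n : nat) (le_mn : (m <= n)%N)
    (a : R) (M : 'M[R]_(m, n)) :
  diag_weight le_mn (a *: M) = a * diag_weight le_mn M.
Proof.
by rewrite /diag_weight mulr_sumr; apply: eq_bigr => i _; rewrite !mxE mulrCA.
Qed.

Lemma diag_weightN (R : realType) (m n : nat) (le_mn : (m <= n)%N)
    (M : 'M[R]_(m, n)) : diag_weight le_mn (- M) = - diag_weight le_mn M.
Proof. by rewrite -scaleN1r diag_weightZ mulN1r. Qed.

(** Rotations are combinations of elementary matrices, so their effect on the functional reduces to
    such values. *)
Lemma diag_weight_mull_delta (R : realType) (m n : nat) (le_mn : (m <= n)%N)
    (N : 'M[R]_(m, n)) (a b : 'I_m) :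
  diag_weight le_mn (delta_mx a b *m N) = (m - a)%:R * N b (widen_ord le_mn a).
Proof.
rewrite /diag_weight (bigD1 a)//= big1 ?addr0.
  rewrite mxE (bigD1 b)//= big1 ?addr0 => [|k kb]; rewrite mxE eqxx ?eqxx ?mul1r//.
  by rewrite (negPf kb) mul0r.
move=> l la; rewrite mxE big1 ?mulr0// => k _.
by rewrite mxE (negPf la) mul0r.
Qed.

Lemma diag_weight_mulr_delta (R : realType) (m n : nat) (le_mn : (m <= n)%N)
    (N : 'M[R]_(m, n)) (a : 'I_n) (b : 'I_m) :
  diag_weight le_mn (N *m delta_mx a (widen_ord le_mn b)) = (m - b)%:R * N b a.
Proof.
rewrite /diag_weight (bigD1 b)//= big1 ?addr0.
  rewrite mxE (bigD1 a)//= big1 ?addr0 => [|k ka]; rewrite mxE ?eqxx ?mulr1//.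
  by rewrite (negPf ka) mulr0.
move=> l lb; rewrite mxE big1 ?mulr0// => k _.
by rewrite mxE [X in _ && X]negbTE ?andbF ?mulr0// (inj_eq val_inj)/=.
Qed.

Lemma diag_weight_mulr_delta0 (R : realType) (m n : nat) (le_mn : (m <= n)%N)
    (N : 'M[R]_(m, n)) (a b : 'I_n) : (m <= b)%N ->
  diag_weight le_mn (N *m delta_mx a b) = 0.
Proof.
move=> mb; rewrite /diag_weight big1// => l _; rewrite mxE big1 ?mulr0// => k _.
rewrite mxE [X in _ && X]negbTE ?andbF ?mulr0//.
by apply: contraTneq mb => <- /=; rewrite -ltnNge.
Qed.

(** The rotation with cosine [c] and sine [s] in the plane of axes [i] and [j], expanded so that a
    linear functional of it is affine in [c - 1] and [s]. *)
Definition givens_mx (R : realType) (n : nat) (i j : 'I_n) (c s : R) : 'M[R]_n :=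
  1%:M + (c - 1) *: (delta_mx i i + delta_mx j j) +
    s *: (delta_mx i j - delta_mx j i).

(** With [P] the projector on the plane and [K] skew, [K *m K = - P] and [P *m K = K *m P = K]; the
    product with the transpose is the identity plus [(c ^+ 2 + s ^+ 2 - 1) *: P]. *)
Lemma orthogonal_givens (R : realType) (n : nat) (i j : 'I_n) (c s : R) :
  i != j -> c ^+ 2 + s ^+ 2 = 1 -> orthogonal_mx (givens_mx i j c s).
Proof.
move=> ij cs; rewrite /orthogonal_mx /givens_mx.
set P := delta_mx i i + delta_mx j j; set K := delta_mx i j - delta_mx j i.
have ji : (j == i) = false by rewrite eq_sym (negPf ij).
have E := (mul_delta_mx_cond, eqxx, negPf ij, ji, mulr0n, mulr1n, addr0, add0r, subr0).
have PP : P *m P = P by rewrite /P mulmxDl !mulmxDr !E.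
have PK : P *m K = K by rewrite /P /K mulmxDl !mulmxBr !E.
have KP : K *m P = K by rewrite /P /K mulmxBl !mulmxDr !E.
have KK : K *m K = - P by rewrite /P /K mulmxBl !mulmxBr !E ?opprB ?opprD 1?addrC.
have PT : P^T = P by rewrite /P raddfD/= !trmx_delta.
have KT : K^T = - K by rewrite /K raddfB/= !trmx_delta opprB.
move: P K PP PK KP KK PT KT => P K PP PK KP KK PT KT {E}.
have -> : (1%:M + (c - 1) *: P + s *: K)^T = 1%:M + (c - 1) *: P - s *: K.
  by rewrite !raddfD/= !linearZ/= trmx1 PT KT scalerN.
rewrite !(mulmxDl, mulmxDr, mulmxN, mulNmx, mulmx1, mul1mx) -!scalemxAl -!scalemxAr PP PK KP KK.
apply/matrixP => x y; rewrite !mxE; move: (P x y) (K x y) (_ *+ _) => p k d.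
transitivity (d + (c ^+ 2 + s ^+ 2 - 1) * p); first by ring.
by rewrite cs subrr mul0r addr0.
Qed.

(** [B] is the derivative in the angle at the identity rotation, where the maximum is attained. *)
Lemma rotation_max_eq0 (R : realType) (A B : R) :
  (forall c s, c ^+ 2 + s ^+ 2 = 1 -> (c - 1) * A + s * B <= 0) -> B = 0.
Proof.
move=> cs; apply/eqP/negPn/negP => B0.
pose u := `|A| + 1; have u0 : 0 < u by rewrite ltr_wpDl.
have Au : A < u by rewrite (le_lt_trans (ler_norm A))// ltrDl.
pose D := u ^+ 2 + B ^+ 2; have D0 : 0 < D by rewrite ltr_pwDl ?sqr_ge0 ?exprn_gt0.
(* The point of the circle with half-angle tangent [B / u]; the choice [u > A] makes the value
   positive unless [B] is 0. *)
have := cs ((u ^+ 2 - B ^+ 2) / D) (2 * u * B / D).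
have -> : ((u ^+ 2 - B ^+ 2) / D) ^+ 2 + (2 * u * B / D) ^+ 2 = 1.
  by rewrite /D; field; rewrite -/D gt_eqF.
move=> /(_ erefl).
have -> : ((u ^+ 2 - B ^+ 2) / D - 1) * A + 2 * u * B / D * B = 2 * B ^+ 2 * (u - A) / D.
  by rewrite /D; field; rewrite -/D gt_eqF.
apply/negP; rewrite -ltNge divr_gt0// mulr_gt0 ?subr_gt0// mulr_gt0//.
by rewrite lt_neqAle sqr_ge0 eq_sym sqrf_eq0 B0.
Qed.

(** Each conclusion comes from a competitor: plane rotations kill the off-diagonal entries, a
    reflection gives the signs, and a simultaneous exchange of rows and columns gives the order. *)
Lemma diag_weight_max_diag (R : realType) (m n : nat) (le_mn : (m <= n)%N)
    (N : 'M[R]_(m, n)) :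
  (forall G H, orthogonal_mx G -> orthogonal_mx H ->
     diag_weight le_mn (G *m N *m H) <= diag_weight le_mn N) ->
  exists s : 'rV[R]_m, [/\ N = rdiag_mx n s, forall i, 0 <= s 0 i &
    forall i j : 'I_m, (i <= j)%N -> s 0 j <= s 0 i].
Proof.
move=> Nmax; pose w := widen_ord le_mn; pose d (i : 'I_m) : R := (m - i)%:R.
have d0 i : 0 < d i by rewrite ltr0n subn_gt0.
have Nr (i j : 'I_n) : i != j ->
    diag_weight le_mn (N *m delta_mx i j) = diag_weight le_mn (N *m delta_mx j i).
  move=> ij; apply/eqP; rewrite -subr_eq0; apply/eqP.
  apply: (@rotation_max_eq0 _ (diag_weight le_mn (N *m (delta_mx i i + delta_mx j j)))) => c s cs.
  have := Nmax 1%:M (givens_mx i j c s) (orthogonal_mx1 _ _) (orthogonal_givens ij cs).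
  rewrite mul1mx /givens_mx !(mulmxDr, mulmxN, mulmx1, =^~ scalemxAr).
  rewrite !(diag_weightD, diag_weightZ, diag_weightN). lra.
have Nl (i j : 'I_m) : i != j ->
    diag_weight le_mn (delta_mx i j *m N) = diag_weight le_mn (delta_mx j i *m N).
  move=> ij; apply/eqP; rewrite -subr_eq0; apply/eqP.
  apply: (@rotation_max_eq0 _ (diag_weight le_mn ((delta_mx i i + delta_mx j j) *m N))) => c s cs.
  have := Nmax (givens_mx i j c s) 1%:M (orthogonal_givens ij cs) (orthogonal_mx1 _ _).
  rewrite mulmx1 /givens_mx !(mulmxDl, mulNmx, mul1mx, =^~ scalemxAl).
  rewrite !(diag_weightD, diag_weightZ, diag_weightN). lra.
have offdiag (i : 'I_m) (j : 'I_n) : (i : nat) != j -> N i j = 0.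
  move=> ij; have [mj|jm] := leqP m j.
    have jw : j != w i by rewrite -(inj_eq val_inj) eq_sym.
    have := Nr j (w i) jw; rewrite diag_weight_mulr_delta diag_weight_mulr_delta0//.
    by move/eqP; rewrite mulf_eq0 gt_eqF ?d0//= => /eqP.
  pose j' := Ordinal jm; have -> : j = w j' by exact: val_inj.
  have ij' : i != j' by rewrite -(inj_eq val_inj).
  have wij : w j' != w i by rewrite -(inj_eq val_inj) eq_sym.
  have := Nr _ _ wij; have := Nl _ _ ij'.
  rewrite !diag_weight_mulr_delta !diag_weight_mull_delta -/(d i) -/(d j') -/w => h1 h2.
  (* Left and right rotations give two linear equations in the entries at [(i, j')] and [(j', i)],
     with determinant [d i ^+ 2 - d j' ^+ 2] up to sign. *)
  have : (d i - d j') * (d i + d j') * N i (w j') = 0.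
    transitivity (d i * (d i * N i (w j') - d j' * N j' (w i)) +
      d j' * (d i * N j' (w i) - d j' * N i (w j'))); first by ring.
    by rewrite h1 h2 !subrr !mulr0 addr0.
  move/eqP; rewrite !mulf_eq0 [X in _ || X || _]gt_eqF ?addr_gt0//= orbF.
  case/orP => [|/eqP//]; rewrite subr_eq0 /d eqr_nat => /eqP e.
  case/eqP: ij'; apply: ord_inj => /=.
  by have im := ltn_ord i; move: e => /= e; lia.
exists (\row_i N i (w i)); split.
- apply/matrixP => i j; rewrite !mxE; case: eqP => [ij|/eqP]; last exact: offdiag.
  by congr (N _ _); apply: val_inj.
- move=> i; rewrite mxE.
  (* The competitor flips the sign of column [w i]. *)
  have := Nmax 1%:M (1%:M + (- 2) *: delta_mx (w i) (w i)) (orthogonal_mx1 _ _).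
  rewrite mul1mx mulmxDr mulmx1 -scalemxAr diag_weightD diag_weightZ diag_weight_mulr_delta.
  rewrite gerDl mulNr oppr_le0 !pmulr_rge0 ?d0//; apply.
  rewrite /orthogonal_mx.
  have -> : (1%:M + - 2 *: delta_mx (w i) (w i))^T = 1%:M + - 2 *: delta_mx (w i) (w i) :> 'M[R]_n.
    by rewrite raddfD/= trmx1 linearZ/= trmx_delta.
  rewrite !(mulmxDl, mulmxDr, mul1mx, mulmx1, =^~ scalemxAl, =^~ scalemxAr).
  rewrite mul_delta_mx; apply/matrixP => x y; rewrite !mxE.
  by move: (_ *+ _) (_ && _) => a b; ring.
move=> i j; rewrite leq_eqVlt => /orP[/eqP/val_inj->//|ij]; rewrite !mxE.
have orth_perm k (t : 'S_k) : orthogonal_mx (perm_mx t : 'M[R]_k).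
  by rewrite /orthogonal_mx tr_perm_mx -perm_mxM mulgV perm_mx1.
have := Nmax (perm_mx (tperm i j)) (perm_mx (tperm (w i) (w j))) (orth_perm _ _) (orth_perm _ _).
rewrite -row_permE -[perm_mx (tperm (w i) _)]trmxK tr_perm_mx tpermV.
rewrite tr_perm_mx -col_permE.
have wt k : tperm (w i) (w j) (w k) = w (tperm i j k).
  case: (tpermP i j k) => [->|->|/eqP ki /eqP kj]; rewrite ?tpermL ?tpermR//.
  by rewrite tpermD// -(inj_eq val_inj)/= eq_sym.
have ji : j != i by rewrite -(inj_eq val_inj) gtn_eqF.
rewrite /diag_weight (bigD1 i)//= (bigD1 j)//= [leRHS](bigD1 i)//= [X in _ <= _ + X](bigD1 j)//=.
under eq_bigr => k /andP[ki kj] do rewrite !mxE (wt k) tpermD// 1?eq_sym//.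
rewrite !mxE -/(w i) -/(w j) !wt tpermL tpermR !addrA lerD2r -/(d i) -/(d j).
(* Exchanging the two diagonal entries gains nothing, so the larger weight carries the larger
   entry. *)
have : d j < d i by rewrite ltr_nat; move: (ltn_ord j); lia.
move: (N i _) (N j _) => a b; nra.
Qed.

Lemma svd_exists (R : realType) (m n : nat) (X : 'M[R]_(m, n)) : (m <= n)%N ->
  exists U s V, is_svd X U s V.
Proof.
move=> le_mn; have [U [V [Uo Vo UVmax]]] := diag_weight_max le_mn X.
have [|s [Ns s0 smono]] := @diag_weight_max_diag R m n le_mn (U^T *m X *m V).
  move=> G H Go Ho; have := UVmax (U *m G^T) (V *m H).
  rewrite trmx_mul trmxK !mulmxA; apply; apply: orthogonal_mxM => //; exact: orthogonal_mx_tr.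
exists U, s, V; split => //; rewrite -Ns !mulmxA Uo mul1mx -mulmxA.
by rewrite Vo mulmx1.
Qed.

(** * Von Neumann's trace inequality and uniqueness of singular values *)

(* [u] and [v] solve the dual of the assignment problem with costs [x i * y j]. *)
Lemma sorted_product_potentials (R : realType) (m : nat) (x y : nat -> R) :
  (forall i, 0 <= x i) -> (forall i, 0 <= y i) ->
  (forall i j, (i <= j)%N -> x j <= x i) -> (forall i j, (i <= j)%N -> y j <= y i) ->
  x m = 0 -> y m = 0 ->
  exists u v : nat -> R, [/\ forall i, 0 <= u i, forall i, 0 <= v i,
    forall i, u i + v i = x i * y i & forall i j, x i * y j <= u i + v j].
Proof.
elim: m x y => [|m IH] x y x0 y0 xmono ymono xm ym.
  have xz i : x i = 0 by apply/eqP; rewrite eq_le x0 andbT -xm xmono.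
  have yz i : y i = 0 by apply/eqP; rewrite eq_le y0 andbT -ym ymono.
  by exists (fun=> 0), (fun=> 0); split => // *; rewrite ?xz ?yz mul0r addr0.
have [||||||u [v [u0 v0 uv uvle]]] := IH (x \o S) (y \o S) => //=.
- by move=> i j ij; exact: xmono.
- by move=> i j ij; exact: ymono.
have x10 := xmono 0%N 1%N isT; have y10 := ymono 0%N 1%N isT.
have := uv 0%N => /= uv0.
(* The potentials of the shifted sequences are kept; the two increments at index 0 add up to
   [x 0 * y 0 - x 1 * y 1]. *)
exists (fun k => if k is k'.+1 then u k' else u 0%N + y 0%N * (x 0%N - x 1%N)).
exists (fun k => if k is k'.+1 then v k' else v 0%N + x 1%N * (y 0%N - y 1%N)).
split.
- by case=> [|i]; [rewrite addr_ge0// mulr_ge0// subr_ge0|exact: u0].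
- by case=> [|i]; [rewrite addr_ge0// mulr_ge0// subr_ge0|exact: v0].
- by case=> [|i]; [lra|exact: uv].
move=> [|i] [|j] /=.
- by lra.
- have := uvle 0%N j => /= h.
  have : 0 <= (y 0%N - y j.+1) * (x 0%N - x 1%N) by rewrite mulr_ge0 ?subr_ge0 ?ymono.
  by lra.
- have := uvle i 0%N => /= h.
  have : 0 <= (x 1%N - x i.+1) * (y 0%N - y 1%N) by rewrite mulr_ge0 ?subr_ge0 ?xmono.
  by lra.
- exact: uvle.
Qed.

(** Weak duality: bound [x i * y j] by [u i + v j], then use the row sums for [u] and the column
    sums for [v]; the potentials total [\sum_i x i * y i]. *)
Lemma substochastic_sum_le (R : realType) (m : nat) (x y : 'I_m -> R)
    (S : 'I_m -> 'I_m -> R) :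
  (forall i, 0 <= x i) -> (forall i, 0 <= y i) ->
  (forall i j : 'I_m, (i <= j)%N -> x j <= x i) ->
  (forall i j : 'I_m, (i <= j)%N -> y j <= y i) ->
  (forall i j, 0 <= S i j) ->
  (forall i, \sum_j S i j <= 1) -> (forall j, \sum_i S i j <= 1) ->
  \sum_i \sum_j x i * y j * S i j <= \sum_i x i * y i.
Proof.
move=> x0 y0 xmono ymono S0 Srow Scol.
(* Extension by 0 keeps the sequences nonincreasing and makes them vanish at [m]. *)
pose ext (z : 'I_m -> R) k := if insub k is Some i then z i else 0.
have extE z (i : 'I_m) : ext z i = z i by rewrite /ext valK.
have ext0 z : (forall i, 0 <= z i) -> forall k, 0 <= ext z k.
  by move=> z0 k; rewrite /ext; case: insubP.
have extm z : (forall i, 0 <= z i) -> (forall i j : 'I_m, (i <= j)%N -> z j <= z i) ->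
    forall k l, (k <= l)%N -> ext z l <= ext z k.
  move=> z0 zmono k l kl; rewrite {1}/ext; case: insubP => [j lm jl|_]; last exact: ext0.
  rewrite /ext; case: insubP => [i km ik|]; last by rewrite (leq_ltn_trans kl lm).
  by apply: zmono; rewrite ik jl.
have extz z : ext z m = 0 by rewrite /ext insubN ?ltnn.
have [u [v [u0 v0 uv uvle]]] := sorted_product_potentials (ext0 x x0) (ext0 y y0)
  (extm x x0 xmono) (extm y y0 ymono) (extz x) (extz y).
have h (i j : 'I_m) : x i * y j <= u i + v j by rewrite -!extE.
apply: (@le_trans _ _ (\sum_(i < m) \sum_(j < m) (u i + v j) * S i j)).
  by apply: ler_sum => i _; apply: ler_sum => j _; rewrite ler_wpM2r.
have -> : \sum_i x i * y i = \sum_(i < m) u i + \sum_(i < m) v i.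
  by rewrite -big_split; apply: eq_bigr => i _ /=; rewrite uv !extE.
have -> : \sum_(i < m) \sum_(j < m) (u i + v j) * S i j =
    \sum_(i < m) u i * (\sum_j S i j) + \sum_(j < m) v j * (\sum_i S i j).
  under [X in _ = _ + X]eq_bigr => j _ do rewrite mulr_sumr.
  rewrite [X in _ = _ + X]exchange_big -big_split; apply: eq_bigr => i _ /=.
  by rewrite mulr_sumr -big_split; apply: eq_bigr => j _; rewrite mulrDl.
by apply: lerD; apply: ler_sum => i _; rewrite ler_piMr.
Qed.

Lemma sum_widen_ord_le (R : realType) (m n : nat) (le_mn : (m <= n)%N)
    (F : 'I_n -> R) : (forall l, 0 <= F l) ->
  \sum_(i < m) F (widen_ord le_mn i) <= \sum_(l < n) F l.
Proof.
move=> F0; rewrite -(big_ord_narrow le_mn) [leRHS](bigID (fun l : 'I_n => (l < m)%N))/=.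
by rewrite lerDl sumr_ge0.
Qed.

Lemma rdiag_mulE (R : realType) (m n k : nat) (le_mn : (m <= n)%N) (s : 'rV[R]_m)
    (A : 'M[R]_(n, k)) i j :
  (rdiag_mx n s *m A) i j = s 0 i * A (widen_ord le_mn i) j.
Proof.
rewrite mxE (bigD1 (widen_ord le_mn i))//= mxE eqxx big1 ?addr0// => l li.
by rewrite mxE ifN ?mul0r//; apply: contraNneq li => il; apply/eqP/val_inj.
Qed.

Lemma mulr_rdiagE (R : realType) (m n k : nat) (le_mn : (m <= n)%N) (s : 'rV[R]_m)
    (A : 'M[R]_(k, n)) i j :
  (A *m (rdiag_mx n s)^T) i j = A i (widen_ord le_mn j) * s 0 j.
Proof.
by rewrite -[A]trmxK -trmx_mul mxE (rdiag_mulE le_mn) !mxE mulrC.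
Qed.

(** In the singular frames the trace is a sum of [s 0 i * t 0 j] weighted by products of entries of
    two orthogonal matrices. AM-GM replaces each product by a half-sum of squares, and these form a
    doubly substochastic array. *)
Lemma von_neumann_trace (R : realType) (m n : nat) (X Y : 'M[R]_(m, n))
    (U U' : 'M[R]_m) (s t : 'rV[R]_m) (V V' : 'M[R]_n) : (m <= n)%N ->
  is_svd X U s V -> is_svd Y U' t V' ->
  \tr (X *m Y^T) <= \sum_i s 0 i * t 0 i.
Proof.
move=> le_mn [Uo Vo s0 smono ->] [Uo' Vo' t0 tmono ->].
pose P := U'^T *m U; pose Q := V^T *m V'; pose w := widen_ord le_mn.
have Po : orthogonal_mx P by apply: orthogonal_mxM => //; exact: orthogonal_mx_tr.
have Qo : orthogonal_mx Q by apply: orthogonal_mxM => //; exact: orthogonal_mx_tr.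
have -> : \tr (U *m rdiag_mx n s *m V^T *m (U' *m rdiag_mx n t *m V'^T)^T) =
    \sum_i \sum_j s 0 i * t 0 j * (Q (w i) (w j) * P j i).
  rewrite !trmx_mul trmxK -!mulmxA mxtrace_mulC -!mulmxA.
  apply: eq_bigr => i _; rewrite (rdiag_mulE le_mn) !mulmxA -/Q -mulmxA -/P mxE mulr_sumr.
  by apply: eq_bigr => j _; rewrite (mulr_rdiagE le_mn) -/w; ring.
apply: (@le_trans _ _ (\sum_i \sum_j s 0 i * t 0 j *
    ((Q (w i) (w j) ^+ 2 + P j i ^+ 2) / 2))).
  apply: ler_sum => i _; apply: ler_sum => j _; rewrite ler_wpM2l ?mulr_ge0//.
  by have := sqr_ge0 (Q (w i) (w j) - P j i); lra.
have row1 k (O : 'M[R]_k) i : orthogonal_mx O -> \sum_j O i j ^+ 2 = 1.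
  by move=> /orthogonal_mx_entry/(_ i i); rewrite eqxx.
have rowQ (O : 'M[R]_n) i : orthogonal_mx O -> \sum_j O i (w j) ^+ 2 <= 1.
  move=> Oo; rewrite -(row1 _ O i Oo).
  by apply: (sum_widen_ord_le le_mn (F := fun l => O i l ^+ 2)) => l; exact: sqr_ge0.
apply: substochastic_sum_le => //.
- by move=> i j; rewrite divr_ge0// addr_ge0 ?sqr_ge0.
- move=> i; rewrite -mulr_suml big_split/= ler_pdivrMr// mul1r.
  have -> : \sum_j P j i ^+ 2 = 1.
    rewrite -(row1 _ _ i (orthogonal_mx_tr Po)).
    by apply: eq_bigr => j _; rewrite [in RHS]mxE.
  by rewrite -[leRHS]/(1 + 1) lerD2r rowQ.
- move=> j; rewrite -mulr_suml big_split/= ler_pdivrMr// mul1r row1//.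
  rewrite -[leRHS]/(1 + 1) lerD2r.
  apply: le_trans (rowQ _ (w j) (orthogonal_mx_tr Qo)).
  by apply: ler_sum => i _; rewrite [in leRHS]mxE.
Qed.

Lemma trace_same_frames (R : realType) (m n : nat) (U : 'M[R]_m) (s t : 'rV[R]_m)
    (V : 'M[R]_n) : (m <= n)%N -> orthogonal_mx U -> orthogonal_mx V ->
  \tr ((U *m rdiag_mx n s *m V^T) *m (U *m rdiag_mx n t *m V^T)^T) =
  \sum_i s 0 i * t 0 i.
Proof.
move=> le_mn Uo Vo; rewrite !trmx_mul trmxK -!mulmxA mxtrace_mulC -!mulmxA.
rewrite (orthogonal_mxC Uo) mulmx1 (mulmxA V^T) (orthogonal_mxC Vo) mul1mx.
by apply: eq_bigr => i _; rewrite (rdiag_mulE le_mn) !mxE eqxx.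
Qed.

(** For two decompositions of [X], both sums of squares equal [\tr (X *m X^T)], which the trace
    inequality bounds by the mixed sum; hence [\sum_i (s 0 i - s' 0 i) ^+ 2 <= 0]. *)
Lemma sigma_svd (R : realType) (m n : nat) (X : 'M[R]_(m, n)) (U : 'M[R]_m)
    (s : 'rV[R]_m) (V : 'M[R]_n) : (m <= n)%N -> is_svd X U s V -> sigma X = s.
Proof.
move=> le_mn XU.
have uniq_sv U' s' V' : is_svd X U' s' V' -> s' = s.
  move=> XU'; have [Uo Vo _ _ XE] := XU; have [Uo' Vo' _ _ XE'] := XU'.
  have := von_neumann_trace le_mn XU XU'.
  have : \tr (X *m X^T) = \sum_i s 0 i * s 0 i by rewrite [in LHS]XE trace_same_frames.
  have : \tr (X *m X^T) = \sum_i s' 0 i * s' 0 i by rewrite [in LHS]XE' trace_same_frames.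
  move=> h1 h2 h3.
  have : \sum_i (s 0 i - s' 0 i) ^+ 2 <= 0.
    have -> : \sum_i (s 0 i - s' 0 i) ^+ 2 = \sum_i s 0 i * s 0 i +
        \sum_i s' 0 i * s' 0 i - 2 * \sum_i s 0 i * s' 0 i.
      rewrite mulr_sumr -big_split -sumrB; apply: eq_bigr => i _ /=; ring.
    by rewrite -h1 -h2; lra.
  have sq0 (i : 'I_m) : true -> 0 <= (s 0 i - s' 0 i) ^+ 2 by rewrite sqr_ge0.
  move=> le0; have /eqP : \sum_i (s 0 i - s' 0 i) ^+ 2 = 0.
    by apply/eqP; rewrite eq_le le0/=; apply: sumr_ge0 => i _; exact: sqr_ge0.
  rewrite psumr_eq0// => /allP s0; apply/rowP => i.
  have := s0 i (mem_index_enum _); rewrite sqrf_eq0 subr_eq0 => /eqP->.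
  by [].
rewrite /sigma; case: xgetP => [s' _ [U' [V' XU']]|/(_ s)]; first exact: uniq_sv XU'.
by case; exists U, V.
Qed.

(** * Frobenius norm and the matrix proximal inequality *)

Lemma frob_norm_sq (R : realType) (m n : nat) (X : 'M[R]_(m, n)) :
  frob_norm X ^+ 2 = \tr (X *m X^T).
Proof.
rewrite /frob_norm sqr_sqrtr; last first.
  by rewrite sumr_ge0// => i _; rewrite sumr_ge0// => j _; rewrite sqr_ge0.
by apply: eq_bigr => i _; rewrite mxE; apply: eq_bigr => j _; rewrite mxE expr2.
Qed.

Lemma frob_norm_sqB (R : realType) (m n : nat) (X Y : 'M[R]_(m, n)) :
  frob_norm (X - Y) ^+ 2 = \tr (X *m X^T) - 2 * \tr (X *m Y^T) + \tr (Y *m Y^T).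
Proof.
rewrite frob_norm_sq (raddfB (@trmx R m n))/= mulmxBl !mulmxBr !(raddfB (@mxtrace R m))/=.
by rewrite -[\tr (Y *m X^T)]mxtrace_tr trmx_mul trmxK; ring.
Qed.

Lemma rdiag_mxBZ (R : realType) (m n : nat) (a : R) (s t : 'rV[R]_m) :
  rdiag_mx n (s - a *: t) = rdiag_mx n s - a *: rdiag_mx n t.
Proof. by apply/matrixP => i j; rewrite !mxE; case: eqP => _; rewrite ?mulr0 ?subr0. Qed.

(** Expanding the norms leaves [\tr (X *m (Y - mu *: Z)^T)] as the only term not determined by
    singular values. As [Y - mu *: Z] has the frames of [Y] and sorted singular values, the trace
    inequality bounds it, and summing the scalar inequality concludes. *)
Lemma svt_strong_minimizer (R : realType) (m n : nat) (lambda mu : R)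
    (r f : R -> R) (Y : 'M[R]_(m, n)) (U : 'M[R]_m) (y : 'rV[R]_m)
    (V : 'M[R]_n) (X : 'M[R]_(m, n)) :
  (m <= n)%N -> r 0 = 0 ->
  (forall s t, 0 <= s -> s <= t -> 0 <= r t - r s /\ mu * (r t - r s) <= t - s) ->
  (forall x t, 0 <= x -> 0 <= t ->
    lambda * f (r t) + r t ^+ 2 / 2 - t * r t + mu / 2 * (x - r t) ^+ 2 <=
    lambda * f x + x ^+ 2 / 2 - t * x) ->
  is_svd Y U y V ->
  forall Z, Z = U *m rdiag_mx n (map_mx r y) *m V^T ->
  1 / 2 * frob_norm (Z - Y) ^+ 2 + lambda * sv_penalty f Z +
    mu / 2 * frob_norm (X - Z) ^+ 2 <=
  1 / 2 * frob_norm (X - Y) ^+ 2 + lambda * sv_penalty f X.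
Proof.
move=> le_mn r0 rlip rprox YU Z ZE; have [Uo Vo y0 ymono YE] := YU.
have [U' [x [V' XU]]] := svd_exists X le_mn; have [Uo' Vo' x0 xmono XE] := XU.
have rge0 t : 0 <= t -> 0 <= r t.
  by move=> t0; have [] := rlip 0 t (lexx _) t0; rewrite r0 subr0.
have ZU : is_svd Z U (map_mx r y) V.
  split => // [i|i j ij]; rewrite !mxE ?rge0//.
  by have [+ _] := rlip _ _ (y0 j) (ymono i j ij); rewrite subr_ge0.
have YZU : is_svd (Y - mu *: Z) U (y - mu *: map_mx r y) V.
  split => // [i|i j ij|]; rewrite ?mxE.
  - by have [_] := rlip 0 _ (lexx _) (y0 i); rewrite r0 !subr0 subr_ge0.
  - by have [_] := rlip _ _ (y0 j) (ymono i j ij); lra.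
  - by rewrite YE ZE rdiag_mxBZ mulmxBr mulmxBl -scalemxAr -scalemxAl.
have := von_neumann_trace le_mn XU YZU.
rewrite linearB/= linearZ/= mulmxBr -scalemxAr linearB/= linearZ/= => vN.
have YY : \tr (Y *m Y^T) = \sum_i y 0 i * y 0 i by rewrite [in LHS]YE trace_same_frames.
have XX : \tr (X *m X^T) = \sum_i x 0 i * x 0 i by rewrite [in LHS]XE trace_same_frames.
have ZZ : \tr (Z *m Z^T) = \sum_i r (y 0 i) * r (y 0 i).
  by rewrite ZE trace_same_frames//; apply: eq_bigr => i _; rewrite !mxE.
have ZY : \tr (Z *m Y^T) = \sum_i r (y 0 i) * y 0 i.
  by rewrite ZE [in LHS]YE trace_same_frames//; apply: eq_bigr => i _; rewrite mxE.
rewrite !frob_norm_sqB YY XX ZZ ZY /sv_penalty (sigma_svd le_mn XU) (sigma_svd le_mn ZU).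
have : \sum_i (lambda * f (r (y 0 i)) + r (y 0 i) ^+ 2 / 2 - y 0 i * r (y 0 i) +
      mu / 2 * (x 0 i - r (y 0 i)) ^+ 2) <=
    \sum_i (lambda * f (x 0 i) + x 0 i ^+ 2 / 2 - y 0 i * x 0 i).
  by apply: ler_sum => i _; exact: rprox.
have -> : \sum_i (lambda * f (r (y 0 i)) + r (y 0 i) ^+ 2 / 2 - y 0 i * r (y 0 i) +
      mu / 2 * (x 0 i - r (y 0 i)) ^+ 2) =
    lambda * \sum_i f (r (y 0 i)) + 1 / 2 * \sum_i r (y 0 i) * r (y 0 i) -
    \sum_i r (y 0 i) * y 0 i + mu / 2 * (\sum_i x 0 i * x 0 i -
      2 * \sum_i x 0 i * r (y 0 i) + \sum_i r (y 0 i) * r (y 0 i)).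
  rewrite !(mulr_sumr, =^~ sumrB, =^~ big_split)/=; apply: eq_bigr => i _.
  by field.
have -> : \sum_i (lambda * f (x 0 i) + x 0 i ^+ 2 / 2 - y 0 i * x 0 i) =
    lambda * \sum_i f (x 0 i) + 1 / 2 * \sum_i x 0 i * x 0 i - \sum_i x 0 i * y 0 i.
  rewrite !(mulr_sumr, =^~ sumrB, =^~ big_split)/=; apply: eq_bigr => i _.
  by field.
move: vN.
have -> : \sum_i x 0 i * (y - mu *: map_mx r y) 0 i =
    \sum_i x 0 i * y 0 i - mu * \sum_i x 0 i * r (y 0 i).
  rewrite !(mulr_sumr, =^~ sumrB)/=; apply: eq_bigr => i _; rewrite !mxE.
  by ring.
have -> : \sum_i f (map_mx r y 0 i) = \sum_i f (r (y 0 i)).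
  by apply: eq_bigr => i _; rewrite mxE.
by move=> h1 h2; lra.
Qed.

(** * Subadditivity of truncated sums of singular values *)

(* Each new vector [v] enlarges [P] by the projector on the line of
   [v - P *m v]. *)
Lemma fixing_projector (R : realType) (n : nat) (vs : seq 'cV[R]_n) :
  exists P : 'M[R]_n, [/\ P^T = P, P *m P = P,
    forall v, v \in vs -> P *m v = v & \tr P <= (size vs)%:R].
Proof.
elim: vs => [|v vs [P [PT PP Pvs trP]]].
  by exists 0; rewrite trmx0 mul0mx mxtrace0.
pose w := v - P *m v.
have Pw : P *m w = 0 by rewrite /w mulmxBr mulmxA PP subrr.
have wP : w^T *m P = 0 by rewrite -PT -trmx_mul Pw trmx0.
pose a := (w^T *m w) 0 0.
have ww : w^T *m w = a%:M by rewrite [LHS]mx11_scalar.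
have aE : a = \sum_i w i 0 ^+ 2.
  by rewrite /a mxE; apply: eq_bigr => i _; rewrite mxE expr2.
(* If [a] vanishes, [P] already fixes [v]. *)
have [a0|a0] := eqVneq a 0.
  exists P; split=> // [u|]; last by rewrite (le_trans trP)// ler_nat leqnSn.
  rewrite inE => /orP[/eqP->|/Pvs//]; apply/esym/eqP; rewrite -subr_eq0 -/w.
  have w0 : forall i, w i 0 = 0.
    move=> i; move/eqP: a0; rewrite aE psumr_eq0 => [|j _]; last exact: sqr_ge0.
    by move=> /allP/(_ i (mem_index_enum _)); rewrite sqrf_eq0 => /eqP.
  by apply/eqP/matrixP => i j; rewrite !ord1 w0 mxE.
have ww_tr : \tr (w *m w^T) = a by rewrite mxtrace_mulC ww mxtrace_scalar.
exists (P + a^-1 *: (w *m w^T)); split.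
- by rewrite (raddfD (@trmx R n n))/= PT linearZ/= trmx_mul trmxK.
- rewrite mulmxDl !mulmxDr PP -!scalemxAl -!scalemxAr mulmxA Pw mul0mx scaler0.
  rewrite addr0 -(mulmxA w w^T P) wP mulmx0 scaler0 add0r.
  rewrite -(mulmxA w) (mulmxA w^T) ww mul_scalar_mx -scalemxAr scalerA.
  by rewrite mulVf// scale1r.
- move=> u; rewrite inE mulmxDl -scalemxAl -mulmxA => /orP[/eqP->|/[dup] uvs /Pvs Pu].
    have -> : w^T *m v = a%:M.
      by rewrite -ww {3}/w mulmxBr mulmxA wP mul0mx subr0.
    by rewrite mul_mx_scalar scalerA mulVf// scale1r /w addrCA subrr addr0.
  by rewrite -{2}Pu (mulmxA w^T) wP mul0mx mulmx0 scaler0 addr0.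
rewrite (raddfD (@mxtrace R n))/= mxtraceZ ww_tr mulVf//= -natr1.
by rewrite lerD2r.
Qed.

Lemma sum_sqr_row (R : realType) (k n : nat) (A : 'M[R]_(k, n)) i :
  \sum_j A i j ^+ 2 = (A *m A^T) i i.
Proof. by rewrite mxE; apply: eq_bigr => j _; rewrite mxE expr2. Qed.

(** [V^T *m P *m V] is the Gram matrix of the rows of [V^T *m P]; the upper bound is the lower bound
    for the projector [1%:M - P]. *)
Lemma projector_diag_itv (R : realType) (n : nat) (P V : 'M[R]_n) i :
  P^T = P -> P *m P = P -> orthogonal_mx V ->
  0 <= (V^T *m P *m V) i i <= 1.
Proof.
have ge0 (Q : 'M[R]_n) : Q^T = Q -> Q *m Q = Q -> 0 <= (V^T *m Q *m V) i i.
  move=> QT QQ; have -> : V^T *m Q *m V = (V^T *m Q) *m (V^T *m Q)^T.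
    by rewrite trmx_mul trmxK QT !mulmxA -(mulmxA V^T Q Q) QQ.
  by rewrite -sum_sqr_row sumr_ge0// => j _; exact: sqr_ge0.
move=> PT PP Vo; rewrite ge0//=.
have := ge0 (1%:M - P); rewrite (raddfB (@trmx R n n))/= trmx1 PT => /(_ erefl).
rewrite mulmxBl mul1mx mulmxBr mulmx1 PP subrr subr0 => /(_ erefl).
by rewrite mulmxBr mulmxBl mulmx1 (orthogonal_mxC Vo) !mxE eqxx subr_ge0.
Qed.

(* The trace is the sum of the [s 0 i] weighted by the diagonal entries of
   [V^T *m (1%:M - P) *m Z^T *m U]: these are at most 1 by AM-GM, and vanish
   where [P] fixes the right singular vector. *)
Lemma trace_projected_le (R : realType) (m n : nat) (X Z : 'M[R]_(m, n))
    (P : 'M[R]_n) (U : 'M[R]_m) (s : 'rV[R]_m) (V : 'M[R]_n) (c : R)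
    (le_mn : (m <= n)%N) :
  is_svd X U s V -> P^T = P -> P *m P = P -> Z *m Z^T = 1%:M ->
  (forall i, c < s 0 i -> P *m col (widen_ord le_mn i) V = col (widen_ord le_mn i) V) ->
  \tr (X *m (1%:M - P) *m Z^T) <= \sum_(i | s 0 i <= c) s 0 i.
Proof.
move=> [Uo Vo s0 _ ->] PT PP ZZ Ps; pose Q := 1%:M - P; pose w := widen_ord le_mn.
have QT : Q^T = Q by rewrite (raddfB (@trmx R n n))/= trmx1 PT.
have QQ : Q *m Q = Q by rewrite /Q mulmxBl mul1mx mulmxBr mulmx1 PP subrr subr0.
pose A := V^T *m Q; pose B := Z^T *m U.
have -> : \tr (U *m rdiag_mx n s *m V^T *m Q *m Z^T) = \sum_i s 0 i * (A *m B) (w i) i.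
  rewrite -!mulmxA mxtrace_mulC -!mulmxA; apply: eq_bigr => i _.
  by rewrite (rdiag_mulE le_mn) /A /B !mulmxA.
rewrite (bigID (fun i => s 0 i <= c))/= [X in _ + X]big1 ?addr0; last first.
  move=> i; rewrite -ltNge => /Ps Pi.
  rewrite mxE big1 ?mulr0// => k _.
  have colE (M : 'M[R]_n) : M^T = M -> (V^T *m M) (w i) k = (M *m col (w i) V) k 0.
    move=> MT; rewrite -[in LHS]MT [LHS]mxE [RHS]mxE.
    by apply: eq_bigr => l _; rewrite !mxE mulrC.
  rewrite /A colE//.
  by rewrite /Q mulmxBl mul1mx Pi subrr mxE mul0r.
apply: ler_sum => i _; rewrite ler_piMr//.
apply: (@le_trans _ _ (\sum_k ((A (w i) k) ^+ 2 + (B^T i k) ^+ 2) / 2)).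
  rewrite mxE; apply: ler_sum => k _; rewrite [B^T _ _]mxE.
  by have := sqr_ge0 (A (w i) k - B k i); lra.
rewrite -mulr_suml ler_pdivrMr// mul1r big_split/= !sum_sqr_row.
have -> : B^T *m B^T^T = 1%:M.
  rewrite trmxK /B trmx_mul trmxK !mulmxA -(mulmxA _ Z) ZZ mulmx1.
  exact: orthogonal_mxC.
have -> : A *m A^T = V^T *m Q *m V by rewrite /A trmx_mul trmxK QT !mulmxA -(mulmxA V^T) QQ.
have -> : (1%:M : 'M[R]_m) i i = 1 by rewrite mxE eqxx.
rewrite -[leRHS]/(1 + 1) lerD2r.
by have /andP[] := projector_diag_itv (w i) QT QQ Vo.
Qed.

(** Compare two bounds of [\tr ((X + Y) *m (1%:M - P) *m Z^T)]. From above, only the singular values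
    of [X] and [Y] up to [c] remain. From below, the projection costs at most [c] times the rank of
    [P], which pays for the truncated values equal to [c] on the right. *)
Lemma sum_min_sv_subadd (R : realType) (m n : nat) (X Y : 'M[R]_(m, n))
    (c : R) : (m <= n)%N -> 0 <= c ->
  \sum_i Num.min (sigma (X + Y) 0 i) c <=
  \sum_i Num.min (sigma X 0 i) c + \sum_i Num.min (sigma Y 0 i) c.
Proof.
move=> le_mn c0; pose w := widen_ord le_mn.
have [U0 [s [V0 WU]]] := svd_exists (X + Y) le_mn; rewrite (sigma_svd le_mn WU).
have [U1 [x [V1 XU]]] := svd_exists X le_mn; rewrite (sigma_svd le_mn XU).
have [U2 [y [V2 YU]]] := svd_exists Y le_mn; rewrite (sigma_svd le_mn YU).
have [U0o V0o s0 _ WE] := WU.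
pose I1 := [set i | c < x 0 i]%SET; pose I2 := [set i | c < y 0 i]%SET.
have [P [PT PP Pfix trP]] := fixing_projector
  ([seq col (w i) V1 | i <- enum I1] ++ [seq col (w i) V2 | i <- enum I2]).
(* The polar factor of [X + Y]: pairing with it sums the singular values. *)
pose Z := U0 *m rdiag_mx n (const_mx 1) *m V0^T.
have ZZ : Z *m Z^T = 1%:M.
  rewrite /Z !trmx_mul trmxK !mulmxA -(mulmxA _ V0^T) (orthogonal_mxC V0o) mulmx1.
  have -> : U0 *m rdiag_mx n (const_mx 1) *m (rdiag_mx n (const_mx 1))^T = U0.
    rewrite -mulmxA [X in _ *m X](_ : _ = 1%:M) ?mulmx1//.
    apply/matrixP => i j; rewrite (rdiag_mulE le_mn) !mxE mul1r -val_eqE/= eq_sym.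
    by case: eqP.
  exact: U0o.
have hX : \tr (X *m (1%:M - P) *m Z^T) <= \sum_(i | x 0 i <= c) x 0 i.
  apply: (trace_projected_le XU PT PP ZZ) => i ci; apply: Pfix.
  by rewrite mem_cat; apply/orP; left; apply: map_f; rewrite mem_enum finset.in_set.
have hY : \tr (Y *m (1%:M - P) *m Z^T) <= \sum_(i | y 0 i <= c) y 0 i.
  apply: (trace_projected_le YU PT PP ZZ) => i ci; apply: Pfix.
  by rewrite mem_cat; apply/orP; right; apply: map_f; rewrite mem_enum finset.in_set.
pose p i := (V0^T *m P *m V0) i i.
have p01 i : 0 <= p i <= 1 by exact: projector_diag_itv.
have hW : \tr ((X + Y) *m (1%:M - P) *m Z^T) = \sum_i s 0 i * (1 - p (w i)).
  rewrite WE /Z !trmx_mul trmxK -!mulmxA mxtrace_mulC -!mulmxA.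
  rewrite (orthogonal_mxC U0o) mulmx1; apply: eq_bigr => i _.
  rewrite (rdiag_mulE le_mn) !mulmxA (mulr_rdiagE le_mn) [const_mx _ _ _]mxE mulr1; congr (_ * _).
  by rewrite mulmxBr mulmx1 mulmxBl (orthogonal_mxC V0o) !mxE eqxx /p !mxE.
have sump : \sum_(i < m) p (w i) <= (#|I1| + #|I2|)%:R.
  apply: le_trans (_ : \tr P <= _).
    apply: (le_trans (sum_widen_ord_le le_mn (F := p) _)).
      by move=> l; have /andP[] := p01 l.
    rewrite -[leLHS]/(\tr (V0^T *m P *m V0)) mxtrace_mulC mulmxA V0o mul1mx lexx.
    by [].
  by move: trP; rewrite size_cat !size_map -!cardE.
have lowW : \sum_i Num.min (s 0 i) c - c * (#|I1| + #|I2|)%:R <=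
    \sum_i s 0 i * (1 - p (w i)).
  apply: (@le_trans _ _ (\sum_i (Num.min (s 0 i) c - c * p (w i)))).
    by rewrite sumrB -mulr_sumr lerD2l lerN2 ler_wpM2l.
  (* [Num.min s c - c * p <= s * (1 - p)] amounts to [0 <= (c - s) * p] or
     [0 <= (s - c) * (1 - p)]. *)
  apply: ler_sum => i _; have /andP[p0 p1] := p01 (w i).
  have [sc|cs] := leP (s 0 i) c.
    by have h : 0 <= (c - s 0 i) * p (w i); [rewrite mulr_ge0 ?subr_ge0|lra].
  by have h : 0 <= (s 0 i - c) * (1 - p (w i)); [rewrite mulr_ge0 ?subr_ge0 ?(ltW cs)|lra].
have splitmin (z : 'rV[R]_m) : \sum_i Num.min (z 0 i) c =
    \sum_(i | z 0 i <= c) z 0 i + c * #|[set i | c < z 0 i]%SET|%:R.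
  rewrite (bigID (fun i => z 0 i <= c))/=; congr (_ + _).
    by apply: eq_bigr => i zc; rewrite min_l.
  under eq_bigl do rewrite -ltNge.
  rewrite (eq_bigr (fun=> c)) => [|i cz]; last by rewrite min_r// ltW.
  rewrite sumr_const mulr_natr; congr (_ *+ _); apply: eq_card => i.
  by rewrite finset.in_set.
rewrite !splitmin -/I1 -/I2; move: hW; rewrite !mulmxDl (raddfD (@mxtrace R m))/=.
by move: lowW; rewrite natrD splitmin; lra.
Qed.

(** * From truncations to concave penalties *)

(** Chord slopes decrease along successive intervals; cross-multiplication admits degenerate
    intervals. *)
Definition slope_decr (R : realType) (f : R -> R) : Prop :=
  forall x y z u, 0 <= x -> x <= y -> y <= z -> z <= u ->
    (f u - f z) * (y - x) <= (f y - f x) * (u - z).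

(* Piecewise linear interpolation at the nodes [t :: ts], listed decreasingly:
   subtracting from [f] its slope on the last interval reduces to the remaining
   nodes. *)
Lemma slope_decr_min_decomp (R : realType) (ts : seq R) (f : R -> R) (t : R) :
  slope_decr f -> f 0 = 0 -> 0 <= t -> (forall u, u \in ts -> 0 <= u) ->
  (forall x y, 0 <= x -> x <= y -> y <= t -> f x <= f y) -> path >=%R t ts ->
  exists cs : seq (R * R), [/\ forall c, c \in cs -> [/\ 0 <= c.1, 0 <= c.2 & c.2 <= t] &
    forall u, u \in t :: ts -> f u = \sum_(c <- cs) c.1 * Num.min u c.2].
Proof.
elim: ts f t => [|t' ts IH] f t fconc f0 t0 ts0 fmono.
  move=> _; exists [:: (f t / t, t)]; split=> [c|u]; rewrite inE => /eqP->/=.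
    by split => //; rewrite divr_ge0// -f0 fmono.
  rewrite big_seq1/= minxx; have [->|tn0] := eqVneq t 0; first by rewrite f0 mulr0.
  by rewrite mulfVK.
move=> /= /andP[t't tts].
have t'0 : 0 <= t' by rewrite ts0// mem_head.
have ts0' u : u \in ts -> 0 <= u by move=> uts; rewrite ts0// inE uts orbT.
have le_t' u : u \in t' :: ts -> 0 <= u <= t'.
  rewrite inE => /orP[/eqP->|uts]; first by rewrite t'0 lexx.
  rewrite ts0'//=; have /allP := order_path_min (rev_trans le_trans) tts.
  by apply.
have [tt'|tnt'] := eqVneq t t'.
  have [|cs [cs0 csf]] := IH f t' fconc f0 t'0 ts0' _ tts.
    by move=> x y x0 xy yt'; rewrite fmono// tt'.
  by exists cs; rewrite tt'; split => // u; rewrite inE => /orP[/eqP->|]; [rewrite csf// mem_head|exact: csf].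
have {tnt'}t't : t' < t by rewrite lt_neqAle eq_sym tnt'.
have tt'0 : 0 < t - t' by rewrite subr_gt0.
pose d := (f t - f t') / (t - t').
have d0 : 0 <= d by rewrite divr_ge0 ?(ltW tt'0)// subr_ge0 fmono// ltW.
pose g x := f x - d * x.
have [|||cs [cs0 csg]] := IH g t' _ _ t'0 ts0' _ tts.
- by move=> x y z u x0 xy yz zu; have := fconc x y z u x0 xy yz zu; rewrite /g; lra.
- by rewrite /g f0 mulr0 subrr.
(* The slope [d] of the last interval is the smallest, so [g] stays nondecreasing up to [t']. *)
- move=> x y x0 xy yt'; rewrite -subr_ge0.
  have := fconc x y t' t x0 xy yt' (ltW t't).
  have -> : f t - f t' = d * (t - t') by rewrite /d divfK// gt_eqF.
  rewrite mulrAC ler_pM2r// /g; lra.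
exists ((d, t) :: cs); split=> [c|u].
  rewrite inE => /orP[/eqP->/=|/cs0[? ? ct']]; first by split.
  by split => //; rewrite (le_trans ct')// ltW.
rewrite inE big_cons/= => /orP[/eqP->|ut'].
  have -> : f t = g t' + d * t.
    by have : f t - f t' = d * (t - t'); [rewrite /d divfK// gt_eqF|rewrite /g; lra].
  (* The remaining truncation levels are at most [t'], so these terms agree at [t] and [t']. *)
  rewrite minxx addrC; congr (_ + _); rewrite (csg t' (mem_head _ _)) !big_seq.
  apply: eq_bigr => c /cs0[_ _ ct']; rewrite !min_r//.
  exact: le_trans (ltW t't).
have /andP[_ ule] := le_t' u ut'.
by rewrite -csg// min_l ?(le_trans ule (ltW t't))// /g; lra.
Qed.

(** Weak majorization: on the finitely many values involved, [f] is one nonnegative combination of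
    truncations, for each of which the inequality is assumed. *)
Lemma slope_decr_sum_le (R : realType) (I J : finType) (f : R -> R) (x : I -> R)
    (y : J -> R) : slope_decr f -> f 0 = 0 ->
  (forall s t, 0 <= s -> s <= t -> f s <= f t) ->
  (forall i, 0 <= x i) -> (forall j, 0 <= y j) ->
  (forall c, 0 <= c -> \sum_i Num.min (x i) c <= \sum_j Num.min (y j) c) ->
  \sum_i f (x i) <= \sum_j f (y j).
Proof.
move=> fconc f0 fmono x0 y0 xy.
pose ts := sort >=%R (0 :: codom x ++ codom y).
have ts0 t : t \in ts -> 0 <= t.
  rewrite mem_sort inE mem_cat => /or3P[/eqP->//|/codomP[i ->]//|/codomP[j ->]//].
have : sorted >=%R ts by apply: sort_sorted => a b; exact: le_total.
have : forall t, t \in 0 :: codom x ++ codom y -> t \in ts by move=> t; rewrite mem_sort.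
case: ts ts0 => [|t ts] ts0 mem_ts; first by have := mem_ts 0 (mem_head _ _).
move=> /= tts.
have [| |cs [cs0 csf]] := slope_decr_min_decomp fconc f0 (ts0 t (mem_head _ _)) _ _ tts.
- by move=> u uts; rewrite ts0// inE uts orbT.
- by move=> a b a0 ab _; exact: fmono.
have fx i : f (x i) = \sum_(c <- cs) c.1 * Num.min (x i) c.2.
  by rewrite csf// mem_ts// inE mem_cat codom_f orbT.
have fy j : f (y j) = \sum_(c <- cs) c.1 * Num.min (y j) c.2.
  by rewrite csf// mem_ts// inE mem_cat codom_f !orbT.
rewrite (eq_bigr _ (fun i _ => fx i)) (eq_bigr _ (fun j _ => fy j)).
rewrite exchange_big [leRHS]exchange_big/= !big_seq; apply: ler_sum => c /cs0[c1 c2 _].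
by rewrite -!mulr_sumr ler_wpM2l// xy.
Qed.

Lemma sv_penalty_subadd (R : realType) (m n : nat) (f : R -> R)
    (X Y : 'M[R]_(m, n)) : (m <= n)%N -> slope_decr f -> f 0 = 0 ->
  (forall s t, 0 <= s -> s <= t -> f s <= f t) ->
  sv_penalty f (X + Y) <= sv_penalty f X + sv_penalty f Y.
Proof.
move=> le_mn fconc f0 fmono.
have sigma_ge0 (Z : 'M[R]_(m, n)) i : 0 <= sigma Z 0 i.
  have [U [s [V ZU]]] := svd_exists Z le_mn; rewrite (sigma_svd le_mn ZU).
  by case: ZU.
(* The disjoint sum joins the singular values of [X] and [Y] into one family. *)
pose z (k : 'I_m + 'I_m) := match k with inl i => sigma X 0 i | inr i => sigma Y 0 i end.
have := slope_decr_sum_le (x := fun i => sigma (X + Y) 0 i) (y := z) fconc f0 fmono.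
rewrite big_sumType/=; apply => // [[i|i]|c c0]; rewrite ?big_sumType/=//.
exact: sum_min_sv_subadd.
Qed.

(** Up to the factor [lambda], the slope on [[x, y]] is at least [h y - y], that on [[z, u]] is at
    most [h z - z], and [h - id] is nonincreasing. *)
Lemma prox_penalty_slope_decr (R : realType) (lambda : R) (r : R -> R) (xi mu : R)
    (h f : R -> R) : 0 < lambda -> threshold_inverse r xi mu h ->
  prox_penalty lambda mu h f -> slope_decr f.
Proof.
move=> l0 [_ _ _ _ hP] [_ _ fb _ _] x y z u x0 xy yz zu.
have y0 := le_trans x0 xy; have z0 := le_trans y0 yz.
have [_ _ _ /(_ z yz)/andP[_ hzy]] := hP y y0.
have /andP[fxy _] := fb x y x0 xy; have /andP[_ fzu] := fb z u z0 zu.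
have yx0 : 0 <= y - x by rewrite subr_ge0.
have uz0 : 0 <= u - z by rewrite subr_ge0.
rewrite -(ler_pM2l l0) !mulrA.
apply: le_trans (ler_wpM2r yx0 fzu) _; apply: le_trans (ler_wpM2r uz0 fxy).
rewrite mulrAC; apply: ler_wpM2r => //; apply: ler_wpM2r => //; lra.
Qed.

(** * Uniqueness of the minimizer and assembly of the theorem *)

Lemma frob_norm_sqB_le0 (R : realType) (m n : nat) (X Y : 'M[R]_(m, n)) :
  frob_norm (X - Y) ^+ 2 <= 0 -> X = Y.
Proof.
rewrite frob_norm_sq => le0; apply/eqP; rewrite -subr_eq0; apply/eqP/matrixP => i j.
move: (X - Y) le0 => {X Y} Z; rewrite mxE /mxtrace => le0.
have rowE k : (Z *m Z^T) k k = \sum_l Z k l ^+ 2 by rewrite sum_sqr_row.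
have row0 k : 0 <= (Z *m Z^T) k k.
  by rewrite rowE sumr_ge0// => l _; exact: sqr_ge0.
have : \sum_k (Z *m Z^T) k k == 0 by rewrite eq_le le0 sumr_ge0.
rewrite psumr_eq0// => /allP/(_ i (mem_index_enum _))/=; rewrite rowE.
rewrite psumr_eq0 => [|l _]; last exact: sqr_ge0.
by move=> /allP/(_ j (mem_index_enum _)); rewrite sqrf_eq0 => /eqP.
Qed.

Set Strict Implicit.
Unset Implicit Arguments.

(* For the proximal weight lambda the one-sided slope of f at 0 is forced to be
   xi / lambda (= xi `^ (p - 1)), so the subdifferential at 0 is [-1, 1] scaled
   by xi / lambda; it is [-1, 1] itself when xi = lambda (e.g. p = 1). *)
Theorem theorem1 (R : realType) (m n : nat) (lambda p xi : R)
    (le_mn : (m <= n)%N) (lambda_gt0 : 0 < lambda) (p_le1 : p <= 1)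
    (xi_threshold : is_threshold (gthresh lambda p) xi) :
  exists f : R -> R,
    [/\ (forall x, f (- x) = f x),
        {in `[0, +oo[ &, {homo f : x y / x < y}},
        {within `[0, +oo[, continuous f} &
        (forall x, 0 < x -> derivable f x 1)] /\
    [/\ ~ derivable f 0 1 <-> 0 < xi,
        0 < xi -> subdiff f 0 = [set xi / lambda * v | v in `[-1, 1]],
        (forall Y : 'M[R]_(m, n), exists2 Z : 'M[R]_(m, n),
           gsvt lambda p Y = [set Z] &
           argmin (fun X : 'M[R]_(m, n) =>
             1 / 2 * frob_norm (X - Y) ^+ 2 + lambda * sv_penalty f X)
           = [set Z]) &
        (forall s t, xi <= s -> s <= t ->
           t - gthresh lambda p t <= s - gthresh lambda p s) ->
        concave_on `[0, +oo[ f /\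
        forall X Y : 'M[R]_(m, n),
          sv_penalty f (X + Y) <= sv_penalty f X + sv_penalty f Y].
Proof.
have [mu [h rh]] := threshold_inverse_exists lambda_gt0 p_le1 xi_threshold.
have [f fP] := prox_penalty_exists lambda_gt0 rh.
have [mu0 xi0 _ _ _] := rh; have [f0 feven _ fder _] := fP.
have fincr := prox_penalty_incr lambda_gt0 rh fP.
have r0 : gthresh lambda p 0 = 0 by rewrite /gthresh sgr0 mul0r.
have rlip s t : 0 <= s -> s <= t -> 0 <= gthresh lambda p t - gthresh lambda p s /\
    mu * (gthresh lambda p t - gthresh lambda p s) <= t - s.
  move=> s0 st; have /andP[] := thresholding_lipschitz xi_threshold rh s0 st.
  by rewrite pmulr_rge0.
have rprox x t := scalar_prox_ineq (x := x) (y := t) xi_threshold rh fP.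
exists f; split; first split => //.
  apply: continuous_subspaceT.
  by apply: (@lipschitz_cont _ f (xi / lambda)) => x y; exact: prox_penalty_lipschitz rh fP.
split.
- by split => // _; exact: prox_penalty_not_derivable0 rh fP.
- by move=> _; exact: prox_penalty_subdiff0 rh fP.
- move=> Y; have [U [y [V YU]]] := svd_exists Y le_mn.
  have strong := svt_strong_minimizer _ le_mn r0 rlip rprox.
  (* The quadratic gap identifies any minimizer with any thresholded value, so this also shows
     independence from the decomposition. *)
  have unique Z X U' y' V' : is_svd Y U' y' V' ->
      Z = U' *m rdiag_mx n (gthreshv lambda p y') *m V'^T ->
      argmin (fun X => 1 / 2 * frob_norm (X - Y) ^+ 2 + lambda * sv_penalty f X) X ->
      X = Z.
    move=> YU' ZE Xmin; apply: frob_norm_sqB_le0.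
    have := strong _ _ _ _ X YU' _ ZE; have := Xmin Z.
    rewrite -(pmulr_rle0 _ (divr_gt0 mu0 (ltr0Sn R 1))); lra.
  pose Z := U *m rdiag_mx n (gthreshv lambda p y) *m V^T.
  have Zmin : argmin (fun X => 1 / 2 * frob_norm (X - Y) ^+ 2 +
      lambda * sv_penalty f X) Z.
    move=> X; apply: le_trans (strong _ _ _ _ X YU Z erefl).
    by rewrite lerDl mulr_ge0 ?sqr_ge0 ?divr_ge0 ?ltW.
  exists Z; apply/seteqP; split.
  + by move=> Z' [U' [y' [V' [YU' Z'E]]]]; rewrite (unique _ _ _ _ _ YU' Z'E Zmin).
  + by move=> _ ->; exists U, y, V.
  + by move=> X; exact: unique YU erefl.
  + by move=> _ ->.
move=> _; split; first exact: prox_penalty_concave fP.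
move=> X Y; apply: sv_penalty_subadd => //.
  exact: prox_penalty_slope_decr rh fP.
move=> s t s0; rewrite le_eqVlt => /orP[/eqP->//|st].
by apply/ltW/fincr; rewrite ?in_itv/= ?andbT// (le_trans s0)// ltW.
Qed.
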